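(* For $n_1,n_2,n_3,n_4\ge 0$ write $Q(n_1,n_2,n_3,n_4):=n_1^2+n_2^2+n_3^2+n_4^2-n_1n_2+n_2n_4$. The following four identities hold as identities of formal power series in $q$: \begin{align*} \sum_{n_1,n_2,n_3,n_4\geq 0} \frac{q^{Q(n_1,n_2,n_3,n_4)+n_1+n_2+n_3+n_4}}{(q;q)_{n_1}} {n_1\brack n_2}_q{n_1\brack n_4}_q{n_2 \brack n_3}_q&=\frac{1}{(q^2,q^3,q^3,q^4,q^4,q^5,q^5,q^6;q^8)_\infty},\\ \sum_{n_1,n_2,n_3,n_4\geq 0} \frac{q^{Q(n_1,n_2,n_3,n_4)+n_2+n_3+n_4}}{(q;q)_{n_1}} {n_1\brack n_2}_q{n_1\brack n_4}_q{n_2 \brack n_3}_q&= \frac{1}{(q,q^2,q^3,q^4,q^4,q^5,q^6,q^7;q^8)_\infty},\\ \sum_{n_1,n_2,n_3,n_4\geq 0} \frac{q^{Q(n_1,n_2,n_3,n_4)+n_3}}{(q;q)_{n_1}} {n_1\brack n_2}_q{n_1\brack n_4}_q{n_2 \brack n_3}_q&= \frac{1}{(q,q,q^3,q^3,q^5,q^5,q^7,q^7;q^8)_\infty},\\ \sum_{n_1,n_2,n_3,n_4\geq 0} \frac{q^{Q(n_1,n_2,n_3,n_4)}}{(q;q)_{n_1}} {n_1\brack n_2}_q{n_1\brack n_4}_q{n_2 \brack n_3}_q&= \frac{1}{(q,q,q^2,q^4,q^4,q^6,q^7,q^7;q^8)_\infty}. \end{align*}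
   Context: For $n\in\mathbb{N}\cup\{\infty\}$, $(a;q)_n:=\prod_{k=0}^{n-1}(1-aq^k)$ (so $(a;q)_0=1$), and $(a_1,\dots,a_j;q)_n:=(a_1;q)_n\cdots(a_j;q)_n$. The $q$-binomial coefficient is ${m+n\brack m}_q:=\frac{(q;q)_{m+n}}{(q;q)_m(q;q)_n}$ for integers $m,n\ge 0$, and $0$ otherwise; thus ${a\brack b}_q=\frac{(q;q)_a}{(q;q)_b(q;q)_{a-b}}$ if $0\le b\le a$ and ${a\brack b}_q=0$ otherwise. All summation indices are integers. *)

(* Defs.v *)
From HB Require Import structures.
From mathcomp Require Import all_boot all_order all_algebra.
From mathcomp Require Import boolp.
From mathcomp Require Import zify.

#[local] Set Warnings "-redundant-canonical-projection".
Set Implicit Arguments.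
Unset Strict Implicit.
Unset Printing Implicit Defensive.

Import GRing.Theory.
Local Open Scope ring_scope.

Record fps (R : Type) : Type := FPS { coef_fps : nat -> R }.

Notation "{ 'fps' R }" := (fps R) (at level 0, R at level 2, format "{ 'fps'  R }").

Lemma fpsP (R : Type) (f g : {fps R}) :
  (forall d, coef_fps f d = coef_fps g d) -> f = g.
Proof. by case: f g => [f] [g] /= fg; congr FPS; apply: funext. Qed.

HB.instance Definition _ (R : Type) := gen_eqMixin {fps R}.
HB.instance Definition _ (R : Type) := gen_choiceMixin {fps R}.

Section FpsZmod.
Variable R : zmodType.
Implicit Types f g h : {fps R}.

Let add f g : {fps R} := FPS (fun d => coef_fps f d + coef_fps g d).
Let opp f : {fps R} := FPS (fun d => - coef_fps f d).
Let zero : {fps R} := FPS (fun=> 0).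

Fact fps_addA : associative add.
Proof. by move=> f g h; apply: fpsP => d /=; rewrite addrA. Qed.
Fact fps_addC : commutative add.
Proof. by move=> f g; apply: fpsP => d /=; rewrite addrC. Qed.
Fact fps_add0 : left_id zero add.
Proof. by move=> f; apply: fpsP => d /=; rewrite add0r. Qed.
Fact fps_addN : left_inverse zero opp add.
Proof. by move=> f; apply: fpsP => d /=; rewrite addNr. Qed.
HB.instance Definition _ := GRing.isZmodule.Build {fps R}
  fps_addA fps_addC fps_add0 fps_addN.

Lemma coef_fpsD f g d : coef_fps (f + g) d = coef_fps f d + coef_fps g d.
Proof. by []. Qed.
Lemma coef_fpsN f d : coef_fps (- f) d = - coef_fps f d.
Proof. by []. Qed.
Lemma coef_fpsB f g d : coef_fps (f - g) d = coef_fps f d - coef_fps g d.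
Proof. by []. Qed.
Lemma coef_fps0 d : coef_fps (0 : {fps R}) d = 0.
Proof. by []. Qed.
Lemma coef_fps_sum (I : Type) (r : seq I) (P : pred I) (F : I -> {fps R}) d :
  coef_fps (\sum_(i <- r | P i) F i) d = \sum_(i <- r | P i) coef_fps (F i) d.
Proof. by elim/big_rec2: _ => // i x y _ <-. Qed.
End FpsZmod.

Section FpsRing.
Variable R : comNzRingType.
Implicit Types f g h : {fps R}.

Definition fpsC (c : R) : {fps R} := FPS (fun d => if d == 0%N then c else 0).

Let mul f g : {fps R} :=
  FPS (fun d => \sum_(i < d.+1) coef_fps f i * coef_fps g (d - i)).

Let tr n f : {poly R} := \poly_(i < n) coef_fps f i.

Let coef_tr f g n d : (d < n)%N -> coef_fps (mul f g) d = (tr n f * tr n g)`_d.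
Proof.
move=> dn; rewrite coefM; apply: eq_bigr => i _; rewrite !coef_poly.
by rewrite !ifT //; have := ltn_ord i; lia.
Qed.

Fact fps_mulA : associative mul.
Proof.
move=> f g h; apply: fpsP => d; rewrite !(@coef_tr _ _ d.+1) //.
transitivity (tr d.+1 f * (tr d.+1 g * tr d.+1 h))`_d.
  rewrite !coefM; apply: eq_bigr => i _; congr (_ * _).
  by rewrite coef_poly ifT ?(@coef_tr _ _ d.+1) //; lia.
rewrite mulrA !coefM; apply: eq_bigr => i _; congr (_ * _).
by rewrite coef_poly ifT ?(@coef_tr _ _ d.+1) //.
Qed.
Fact fps_mulC : commutative mul.
Proof.
by move=> f g; apply: fpsP => d; rewrite !(@coef_tr _ _ d.+1) // mulrC.
Qed.
Fact fps_mul1 : left_id (fpsC 1) mul.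
Proof.
move=> f; apply: fpsP => d /=; rewrite big_ord_recl /= mul1r subn0 big1 ?addr0 //.
by move=> i _; rewrite mul0r.
Qed.
Fact fps_mulDl : left_distributive mul +%R.
Proof.
move=> f g h; apply: fpsP => d /=; rewrite -big_split /=.
by apply: eq_bigr => i _; rewrite mulrDl.
Qed.
Fact fps_oner_neq0 : fpsC 1 != 0.
Proof. by apply/eqP => /(congr1 (@coef_fps R ^~ 0%N))/eqP; rewrite /= oner_eq0. Qed.
HB.instance Definition _ := GRing.Zmodule_isComNzRing.Build {fps R}
  fps_mulA fps_mulC fps_mul1 fps_mulDl fps_oner_neq0.

Lemma coef_fpsM f g d :
  coef_fps (f * g) d = \sum_(i < d.+1) coef_fps f i * coef_fps g (d - i).
Proof. by []. Qed.
Lemma coef_fps1 d : coef_fps (1 : {fps R}) d = (d == 0%N)%:R.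
Proof. by rewrite /=; case: eqP. Qed.
Lemma coef_fps0M f g : coef_fps (f * g) 0 = coef_fps f 0 * coef_fps g 0.
Proof. by rewrite coef_fpsM big_ord_recl big_ord0 addr0. Qed.

Lemma coef_fpsCM c f d : coef_fps (fpsC c * f) d = c * coef_fps f d.
Proof.
rewrite coef_fpsM big_ord_recl /= subn0 big1 ?addr0 //.
by move=> i _; rewrite mul0r.
Qed.

Lemma coef_fpsX_small f k d :
  coef_fps f 0 = 0 -> (d < k)%N -> coef_fps (f ^+ k) d = 0.
Proof.
move=> f0; elim: k d => // k IHk d dk; rewrite exprS coef_fpsM big1 // => i _.
have [i0|i_gt0] := posnP i; first by rewrite i0 f0 mul0r.
by rewrite IHk ?mulr0 //; have := ltn_ord i; lia.
Qed.

Definition fpsX : {fps R} := FPS (fun d => (d == 1%N)%:R).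

End FpsRing.

Section FpsUnitRing.
Variable R : comUnitRingType.
Implicit Types f g : {fps R}.

Let unit : pred {fps R} := fun f => coef_fps f 0 \is a GRing.unit.

(* With c the constant coefficient of f, 1 / f = (\sum_k (1 - f / c) ^ k) / c,
   and (1 - f / c) ^ k does not contribute to the coefficients d < k. *)
Let inv f : {fps R} :=
  if unit f then
    let c := (coef_fps f 0)^-1 in
    FPS (fun d => c * \sum_(k < d.+1) coef_fps ((1 - fpsC c * f) ^+ k) d)
  else f.

Fact fps_mulVr : {in unit, left_inverse 1 inv *%R}.
Proof.
move=> f uf; rewrite mulrC; have uf' : unit f := uf; rewrite /inv uf'.
set c := _^-1; set h := 1 - _.
have h0 : coef_fps h 0 = 0 by rewrite coef_fpsB coef_fpsCM mulVr ?subrr.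
apply: fpsP => d; pose G := fpsC c * \sum_(k < d.+1) h ^+ k.
have -> : coef_fps (f * FPS (fun d => c * \sum_(k < d.+1) coef_fps (h ^+ k) d)) d
        = coef_fps (f * G) d.
  rewrite !coef_fpsM; apply: eq_bigr => i _; congr (_ * _).
  rewrite coef_fpsCM coef_fps_sum /=; congr (_ * _).
  rewrite -!(big_mkord xpredT (fun k => coef_fps (h ^+ k) (d - i))).
  rewrite [RHS](big_cat_nat (n := (d - i).+1)) //=; last by lia.
  by rewrite [X in _ + X]big_nat_cond [X in _ + X]big1 ?addr0 // => k;
    rewrite andbT => /andP[dk _]; apply: coef_fpsX_small.
rewrite /G mulrA [f * _]mulrC.
have -> : fpsC c * f = 1 - h by rewrite /h opprB addrC subrK.
rewrite -[1 - h]opprB mulNr -subrX1 opprB coef_fpsB coef_fpsX_small ?subr0 //.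
Qed.
Fact fps_unitPl f g : g * f = 1 -> unit f.
Proof.
move/(congr1 (@coef_fps R ^~ 0%N)); rewrite coef_fps0M coef_fps1 => gf.
by apply/unitrPr; exists (coef_fps g 0); rewrite mulrC.
Qed.
Fact fps_invr_out : {in [predC unit], inv =1 id}.
Proof. by move=> f; rewrite inE /= /inv => /negbTE; rewrite /in_mem /= => ->. Qed.
HB.instance Definition _ := GRing.ComNzRing_hasMulInverse.Build {fps R}
  fps_mulVr fps_unitPl fps_invr_out.

Lemma fps_unitE f : (f \is a GRing.unit) = (coef_fps f 0 \is a GRing.unit).
Proof. by []. Qed.
End FpsUnitRing.

Section Convergence.
Variable R : comUnitRingType.

(* Convergence in the usual topology of formal power series: every coefficient
   is eventually constant. *)
Definition fps_cvg (u : nat -> {fps R}) (l : {fps R}) : Prop :=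
  forall d, exists N, forall n, (N <= n)%N -> coef_fps (u n) d = coef_fps l d.

Definition fps_lim (u : nat -> {fps R}) : {fps R} :=
  if pselect (exists l, fps_cvg u l) is left h then sval (cid h) else 0.

Lemma fps_cvg_unique u l l' : fps_cvg u l -> fps_cvg u l' -> l = l'.
Proof.
move=> ul ul'; apply: fpsP => d; have [[N uN] [M uM]] := (ul d, ul' d).
by rewrite -(uN (maxn N M)) ?leq_maxl // uM ?leq_maxr.
Qed.

Lemma fps_cvg_lim u l : fps_cvg u l -> fps_lim u = l.
Proof.
move=> ul; rewrite /fps_lim; case: pselect => [h|]; last by case; exists l.
by apply: fps_cvg_unique ul; apply: (svalP (cid h)).
Qed.

(* Unconditional summation in the same topology: for each d, the coefficient
   of index d is the same for all finite partial sums that contain a suitable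
   finite set s of indices. *)
Definition fps_has_sum (I : eqType) (F : I -> {fps R}) (S : {fps R}) : Prop :=
  forall d, exists2 s : seq I, uniq s &
    forall t : seq I, uniq t -> {subset s <= t} ->
      coef_fps (\sum_(i <- t) F i) d = coef_fps S d.

Lemma fps_has_sum_unique (I : eqType) (F : I -> {fps R}) S S' :
  fps_has_sum F S -> fps_has_sum F S' -> S = S'.
Proof.
move=> FS FS'; apply: fpsP => d; have [[s _ sF] [s' _ s'F]] := (FS d, FS' d).
rewrite -(sF (undup (s ++ s'))) ?undup_uniq ?s'F ?undup_uniq // => i si.
  by rewrite mem_undup mem_cat si orbT.
by rewrite mem_undup mem_cat si.
Qed.

End Convergence.

Section QPochhammer.
Variable R : comUnitRingType.
Implicit Types a p : {fps R}.

Definition qpoch a p (n : nat) : {fps R} := \prod_(k < n) (1 - a * p ^+ k).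

(* The infinite product converges when p has constant coefficient 0
   (lemma qpoch_cvg). *)
Definition qpoch_oo a p : {fps R} := fps_lim (qpoch a p).

Definition qpochs_oo (s : seq {fps R}) p : {fps R} :=
  \prod_(a <- s) qpoch_oo a p.

Definition qbinom p (a b : nat) : {fps R} :=
  if (b <= a)%N then qpoch p p a / (qpoch p p b * qpoch p p (a - b)) else 0.

Lemma qpoch0 a p : qpoch a p 0 = 1.
Proof. by rewrite /qpoch big_ord0. Qed.

Lemma qpochS a p n : qpoch a p n.+1 = qpoch a p n * (1 - a * p ^+ n).
Proof. by rewrite /qpoch big_ord_recr. Qed.

Lemma qpoch_cvg a p :
  coef_fps p 0 = 0 -> fps_cvg (qpoch a p) (qpoch_oo a p).
Proof.
move=> p0; pose l : {fps R} := FPS (fun d => coef_fps (qpoch a p d.+1) d).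
suff ul : fps_cvg (qpoch a p) l by rewrite /qpoch_oo (fps_cvg_lim ul).
move=> d; exists d.+1; elim=> // n IHn; rewrite leq_eqVlt => /predU1P[<- //|dn].
rewrite qpochS mulrBr mulr1 coef_fpsB IHn // mulrA coef_fpsM.
rewrite [X in _ - X]big1 ?subr0 // => i _; rewrite coef_fpsX_small ?mulr0 //.
by lia.
Qed.

(* The divisions in qbinom and in the identities are by invertible series. *)
Lemma qpoch_unit a p n :
  coef_fps a 0 = 0 -> qpoch a p n \is a GRing.unit.
Proof.
move=> a0; apply: rpred_prod => k _.
by rewrite fps_unitE coef_fpsB coef_fps1 coef_fps0M a0 mul0r subr0 unitr1.
Qed.

Lemma qpochs_oo_unit (s : seq {fps R}) p : coef_fps p 0 = 0 ->
  (forall a, a \in s -> coef_fps a 0 = 0) -> qpochs_oo s p \is a GRing.unit.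
Proof.
move=> p0 s0; rewrite /qpochs_oo big_seq; apply: rpred_prod => a /s0 a0.
have [N aN] := qpoch_cvg a p0 0%N.
by rewrite fps_unitE -(aN N) // -fps_unitE qpoch_unit.
Qed.

End QPochhammer.

(* The subtraction is the truncated one of nat, but it never truncates. *)
Definition Qform (n1 n2 n3 n4 : nat) : nat :=
  (n1 ^ 2 + n2 ^ 2 + n3 ^ 2 + n4 ^ 2 - n1 * n2 + n2 * n4)%N.

Lemma QformE (n1 n2 n3 n4 : nat) :
  (Qform n1 n2 n3 n4)%:Z =
  n1%:Z ^+ 2 + n2%:Z ^+ 2 + n3%:Z ^+ 2 + n4%:Z ^+ 2 - n1%:Z * n2%:Z
    + n2%:Z * n4%:Z.
Proof.
have le : (n1 * n2 <= n1 ^ 2 + n2 ^ 2 + n3 ^ 2 + n4 ^ 2)%N by nia.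
by rewrite /Qform PoszD -subzn // !PoszD !PoszM.
Qed.

(* Main.v *)
Require Import Defs.
From mathcomp Require Import all_boot all_order all_algebra.
From mathcomp Require Import boolp.
From mathcomp Require Import zify ring.

Set Implicit Arguments.
Unset Strict Implicit.
Unset Printing Implicit Defensive.

Import Order.TTheory GRing.Theory Num.Theory.
Local Open Scope ring_scope.

(** Write z for an auxiliary variable and let s = (s0, s1, s2) with sum 8. The
    four products are, up to the factor (q; q)_oo^2, the alternating sums over
    the affine Weyl group of type A2 that the Macdonald identity evaluates, for
    s = (6,1,1), (5,2,1), (4,2,2) and (3,3,2); the four sums are the values at
    z = 1 of the generating functions G_s(z) of cylindric partitions of rank 3
    and profile (s0 - 1, s1 - 1, s2 - 1), counted by their largest part and
    multiplied by (z q; q)_oo. So both sides are reached from one object.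

    That object is cyl_sum s N, the alternating sum in which the term of a Weyl
    group element is divided by three factorials (q; q)_(N + y_i), where
    y_0 + y_1 + y_2 = 0. By the theory of nonintersecting lattice paths it
    counts the cylindric partitions with parts at most N, but only three
    formal properties of it are used. It is 1 at N = 0 (cyl_sum0). As N grows
    it tends to the Macdonald sum divided by (q; q)_oo^3 (cyl_sum_lim). And it
    satisfies the recurrence in N (cyl_sumB1) which comes from
    1 / (q; q)_(M - 1) = (1 - q^M) / (q; q)_M, where the terms with s on a wall of
    the alcove are removed by a reflection (cyl_sum_wall). For the series
    G_s(z) = (z; q)_oo \sum_N (cyl_sum s N) z^N this recurrence is the system of
    functional equations of Corteel and Welsh (cyl_gen_corteel_welsh).

    Eliminating four of its seven unknowns leaves three equations between
    X = G_(5,2,1), Y = G_(4,2,2), W = G_(3,3,2) and their dilates under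
    z -> z q^j (closed_system), and these determine X, Y and W from the constant
    terms (closed_system_zero). The multiple sums, with z^n1 inserted, satisfy
    the same three equations: each equation is a short explicit combination of
    five relations between contiguous sums, which are the recurrences of the
    q-factorials in one summation index at a time (multisum_certificate). Hence
    G_s(z) is the multiple sum (cyl_gen_msum), and letting N tend to infinity in
    cyl_sum s N = \sum_n [z^n] G_s(z) / (q; q)_(N - n) gives the theorem.

    The Macdonald identity itself is obtained by multiplying three Jacobi triple
    products in q^8 and summing first along the diagonal of Z^3, where the inner
    sum is again a triple product: it is (q^8; q^8)_oo by the pentagonal number
    theorem, or 0. *)

(** * Congruences and limits of power series *)

Section Truncation.
Variable R : comUnitRingType.
Implicit Types (f g h : {fps R}) (u v : nat -> {fps R}).

(** Congruence modulo the power d + 1 of the variable. *)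
Definition eqfps d f g := forall e, (e <= d)%N -> coef_fps f e = coef_fps g e.

Lemma eqfpsM d f g f' g' :
  eqfps d f g -> eqfps d f' g' -> eqfps d (f * f') (g * g').
Proof.
move=> fg fg' e ed; rewrite !coef_fpsM; apply: eq_bigr => i _.
have ie := ltn_ord i; rewrite fg ?fg' //; lia.
Qed.

Lemma eqfpsV d f g : f \is a GRing.unit -> g \is a GRing.unit ->
  eqfps d f g -> eqfps d f^-1 g^-1.
Proof.
move=> uf ug fg; have -> : f^-1 = f^-1 * g^-1 * g by rewrite mulrVK.
have {2}-> : g^-1 = f^-1 * g^-1 * f by rewrite mulrAC mulVr ?mul1r.
by apply: eqfpsM => // e ed; rewrite fg.
Qed.

Lemma fps_cvg_eqfps u (l : {fps R}) : fps_cvg u l ->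
  forall d, exists N, forall n, (N <= n)%N -> eqfps d (u n) l.
Proof.
move=> ul; elim=> [|d [N uN]].
  by have [N uN] := ul 0%N; exists N => n /uN un e; rewrite leqn0 => /eqP->.
have [M uM] := ul d.+1; exists (maxn N M) => n nNM e.
rewrite leq_eqVlt => /predU1P[->|]; first by apply: uM; lia.
by move=> ed; apply: uN => //; lia.
Qed.

Lemma fps_cvgM u v (k l : {fps R}) :
  fps_cvg u k -> fps_cvg v l -> fps_cvg (fun n => u n * v n) (k * l).
Proof.
move=> uk vl d; have [N uN] := fps_cvg_eqfps uk d.
have [M vM] := fps_cvg_eqfps vl d; exists (maxn N M) => n nNM.
by apply: eqfpsM (uN _ _) (vM _ _) _ _ => //; lia.
Qed.

Lemma fps_cvgV u (l : {fps R}) : (forall n, u n \is a GRing.unit) ->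
  l \is a GRing.unit -> fps_cvg u l -> fps_cvg (fun n => (u n)^-1) l^-1.
Proof.
move=> uu ul uk d; have [N uN] := fps_cvg_eqfps uk d.
by exists N => n /uN; move/(eqfpsV (uu n) ul); apply.
Qed.

Lemma fps_cvg_cst (l : {fps R}) : fps_cvg (fun=> l) l.
Proof. by move=> d; exists 0%N. Qed.

Lemma fps_cvg_sub u (l : {fps R}) (s : nat -> nat) :
  (forall n, (n <= s n)%N) -> fps_cvg u l -> fps_cvg (u \o s) l.
Proof.
by move=> sn ul d; have [N uN] := ul d; exists N => n nN; apply: uN;
  apply: leq_trans (sn n).
Qed.

Lemma fps_cvg_prod (I : Type) (r : seq I) (u : I -> nat -> {fps R}) l :
  (forall i, fps_cvg (u i) (l i)) ->
  fps_cvg (fun n => \prod_(i <- r) u i n) (\prod_(i <- r) l i).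
Proof.
move=> ul; elim: r => [|i r IHr].
  rewrite big_nil; have -> : (fun n => \prod_(i <- [::]) u i n) = fun=> 1.
    by apply/funext => n; rewrite big_nil.
  exact: fps_cvg_cst.
rewrite big_cons; have -> : (fun n => \prod_(j <- i :: r) u j n) =
    (fun n => u i n * \prod_(j <- r) u j n).
  by apply/funext => n; rewrite big_cons.
exact: fps_cvgM.
Qed.

Lemma coef_fpsXM f d :
  coef_fps (fpsX R * f) d = if d is d'.+1 then coef_fps f d' else 0.
Proof.
rewrite coef_fpsM; case: d => [|d]; first by rewrite big_ord1 mul0r.
rewrite (bigD1 (Ordinal (isT : (1 < d.+2)%N))) //= mul1r subSS subn0.
by rewrite big1 ?addr0 // => i; rewrite -val_eqE /= => /negbTE->; rewrite mul0r.
Qed.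

Lemma coef_fpsXnM k f d :
  coef_fps (fpsX R ^+ k * f) d = if (d < k)%N then 0 else coef_fps f (d - k).
Proof.
elim: k d => [|k IHk] d; first by rewrite mul1r subn0.
by rewrite exprS -mulrA coef_fpsXM; case: d => [|d] //; rewrite IHk.
Qed.

End Truncation.

(** * Unconditional sums of power series *)

Section Summation.
Variable R : comUnitRingType.

Definition fps_summable (I : eqType) (F : I -> {fps R}) :=
  forall d, exists s : seq I, forall i, i \notin s -> coef_fps (F i) d = 0.

Lemma big_support (I : eqType) (c : I -> R) (s t : seq I) : uniq s -> uniq t ->
  (forall i, i \notin s -> c i = 0) -> (forall i, i \notin t -> c i = 0) ->
  \sum_(i <- s) c i = \sum_(i <- t) c i.
Proof.
move=> us ut s0 t0.
have red r : \sum_(i <- r) c i = \sum_(i <- [seq i <- r | c i != 0]) c i.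
  rewrite big_filter [RHS]big_mkcond /=; apply: eq_bigr => i _.
  by case: eqP => [->|].
rewrite red [RHS]red; apply: perm_big.
apply: uniq_perm; rewrite ?filter_uniq //.
move=> i; rewrite !mem_filter; case: eqP => //= ci.
by case: (boolP (i \in s)) => [_|/s0 //]; case: (boolP (i \in t)) => // /t0.
Qed.

Lemma has_sum_coef (I : eqType) (F : I -> {fps R}) S (s : seq I) d :
    fps_has_sum F S -> uniq s ->
    (forall i, i \notin s -> coef_fps (F i) d = 0) ->
  coef_fps S d = \sum_(i <- s) coef_fps (F i) d.
Proof.
move=> FS us s0; have [r ur rF] := FS d.
rewrite -(rF (undup (r ++ s))) ?undup_uniq //; last first.
  by move=> i ir; rewrite mem_undup mem_cat ir.
rewrite coef_fps_sum; apply: big_support; rewrite ?undup_uniq // => i.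
by rewrite mem_undup mem_cat negb_or => /andP[_ /s0].
Qed.

Lemma has_sum_summable (I : eqType) (F : I -> {fps R}) S :
  fps_has_sum F S -> fps_summable F.
Proof.
move=> FS d; have [r ur rF] := FS d; exists r => i ir.
have /rF : uniq (i :: r) by rewrite /= ir.
rewrite big_cons coef_fpsD (rF r) // => h; apply: (addIr (coef_fps S d)).
by rewrite h ?add0r // => j jr; rewrite inE jr orbT.
Qed.

Lemma has_sumP (I : eqType) (F : I -> {fps R}) S :
  (forall d, exists s : seq I, [/\ uniq s,
     forall i, i \notin s -> coef_fps (F i) d = 0 &
     coef_fps S d = \sum_(i <- s) coef_fps (F i) d]) ->
  fps_has_sum F S.
Proof.
move=> h d; have [s [us s0 sS]] := h d; exists s => // t ut st.
rewrite coef_fps_sum sS; apply: big_support => // i.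
by move=> it; apply: s0; apply: contraNN it => /st.
Qed.

Lemma summable_has_sum (I : eqType) (F : I -> {fps R}) :
  fps_summable F -> exists S, fps_has_sum F S.
Proof.
move=> Fs; pose s d := undup (sval (cid (Fs d))).
exists (FPS (fun d => \sum_(i <- s d) coef_fps (F i) d)).
apply: has_sumP => d; exists (s d); split; rewrite ?undup_uniq //.
by move=> i; rewrite mem_undup; apply: (svalP (cid (Fs d))).
Qed.

Definition fps_sum (I : eqType) (F : I -> {fps R}) : {fps R} :=
  if pselect (exists S, fps_has_sum F S) is left h then sval (cid h) else 0.

Lemma fps_sumP (I : eqType) (F : I -> {fps R}) :
  fps_summable F -> fps_has_sum F (fps_sum F).
Proof.
move=> /summable_has_sum h; rewrite /fps_sum.
by case: pselect => // h'; apply: (svalP (cid h')).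
Qed.

Lemma fps_sumE (I : eqType) (F : I -> {fps R}) S :
  fps_has_sum F S -> fps_sum F = S.
Proof.
move=> FS; apply: (fps_has_sum_unique (F := F)) => //.
exact/fps_sumP/(has_sum_summable FS).
Qed.

(** A coefficient of a product involves all lower coefficients of the factors,
    so a list that serves all of them at once is needed. *)
Lemma summable_le (I : eqType) (F : I -> {fps R}) d : fps_summable F ->
  exists2 s : seq I, uniq s &
    forall i, i \notin s -> forall e, (e <= d)%N -> coef_fps (F i) e = 0.
Proof.
move=> Fs; elim: d => [|d [s us s0]].
  have [s s0] := Fs 0%N; exists (undup s); rewrite ?undup_uniq // => i.
  by rewrite mem_undup => /s0 Fi e; rewrite leqn0 => /eqP->.
have [t t0] := Fs d.+1; exists (undup (s ++ t)); rewrite ?undup_uniq // => i.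
rewrite mem_undup mem_cat negb_or => /andP[/s0 Fs_i /t0 Ft_i] e.
by rewrite leq_eqVlt => /predU1P[->//|]; apply: Fs_i.
Qed.

Lemma has_sum_le (I : eqType) (F : I -> {fps R}) S (s : seq I) d :
    fps_has_sum F S -> uniq s ->
    (forall i, i \notin s -> forall e, (e <= d)%N -> coef_fps (F i) e = 0) ->
  eqfps d S (\sum_(i <- s) F i).
Proof.
move=> FS us s0 e ed; rewrite coef_fps_sum; apply: has_sum_coef => // i /s0.
exact.
Qed.

Lemma eq_has_sum (I : eqType) (F G : I -> {fps R}) S :
  F =1 G -> fps_has_sum F S -> fps_has_sum G S.
Proof. by move=> /funext->. Qed.

(** The family need only vanish off the image of f, which covers both
    bijections and the removal of zero terms. *)
Lemma has_sum_reindex (I J : eqType) (f : J -> I) (g : I -> J)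
    (F : I -> {fps R}) S :
    cancel f g -> (forall i, f (g i) <> i -> F i = 0) ->
  fps_has_sum F S <-> fps_has_sum (F \o f) S.
Proof.
move=> fK F0; have out s i : i \notin map f s -> f (g i) = i -> g i \notin s.
  by move=> + fgi; apply: contraNN => gs; apply/mapP; exists (g i).
split=> FS; apply: has_sumP => d.
  have [s us s0] := summable_le d (has_sum_summable FS).
  have s0' j : j \notin undup (map g s) -> coef_fps (F (f j)) d = 0.
    rewrite mem_undup => js; apply: s0 => //; apply: contraNN js => fs.
    by apply/mapP; exists (f j).
  exists (undup (map g s)); split; rewrite ?undup_uniq //=.
  rewrite (has_sum_coef (s := map f (undup (map g s))) FS) ?big_map //.
    by rewrite map_inj_uniq ?undup_uniq //; apply: can_inj fK.
  move=> i ni; case: (eqVneq (f (g i)) i) => [fgi|/eqP/F0->//].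
  by rewrite -fgi; apply: s0'; apply: out ni _; rewrite ?undup_uniq.
have [s us s0] := summable_le d (has_sum_summable FS).
have ufs : uniq (map f s) by rewrite map_inj_uniq //; apply: can_inj fK.
exists (map f s); split=> //.
  move=> i ni; case: (eqVneq (f (g i)) i) => [fgi|/eqP/F0->//].
  by rewrite -fgi; apply: (s0 (g i)) => //; apply: out ni _.
by rewrite big_map (has_sum_coef FS us) // => j /s0; apply.
Qed.

Lemma has_sumD (I : eqType) (F G : I -> {fps R}) S T :
  fps_has_sum F S -> fps_has_sum G T -> fps_has_sum (fun i => F i + G i) (S + T).
Proof.
move=> FS GT; apply: has_sumP => d.
have [s us s0] := summable_le d (has_sum_summable FS).
have [t ut t0] := summable_le d (has_sum_summable GT).
have st0 i : i \notin undup (s ++ t) ->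
    coef_fps (F i) d = 0 /\ coef_fps (G i) d = 0.
  by rewrite mem_undup mem_cat negb_or => /andP[/s0-> // /t0->].
exists (undup (s ++ t)); split; rewrite ?undup_uniq //.
  by move=> i /st0[] /= -> ->; rewrite addr0.
rewrite big_split /= (has_sum_coef (s := undup (s ++ t)) FS) ?undup_uniq //.
  by rewrite (has_sum_coef (s := undup (s ++ t)) GT) ?undup_uniq // => i /st0[].
by move=> i /st0[].
Qed.

Lemma has_sumZ (I : eqType) (F : I -> {fps R}) S c :
  fps_has_sum F S -> fps_has_sum (fun i => c * F i) (c * S).
Proof.
move=> FS; apply: has_sumP => d.
have [s us s0] := summable_le d (has_sum_summable FS).
exists s; split=> // [i /s0 Fi|].
  by rewrite coef_fpsM big1 // => e _; rewrite Fi ?mulr0 // leq_subr.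
rewrite (eqfpsM (fun e _ => erefl (coef_fps c e)) (has_sum_le FS us s0)) //.
by rewrite mulr_sumr coef_fps_sum.
Qed.

Lemma has_sumN (I : eqType) (F : I -> {fps R}) S :
  fps_has_sum F S -> fps_has_sum (fun i => - F i) (- S).
Proof.
move=> /(has_sumZ (-1)); rewrite mulN1r; apply: eq_has_sum => i.
by rewrite mulN1r.
Qed.

Lemma has_sumM (I J : eqType) (F : I -> {fps R}) (G : J -> {fps R}) S T :
  fps_has_sum F S -> fps_has_sum G T ->
  fps_has_sum (fun ij : I * J => F ij.1 * G ij.2) (S * T).
Proof.
move=> FS GT; apply: has_sumP => d.
have [s us s0] := summable_le d (has_sum_summable FS).
have [t ut t0] := summable_le d (has_sum_summable GT).
exists [seq (i, j) | i <- s, j <- t]; split.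
- by apply: allpairs_uniq => // -[? ?] [? ?].
- move=> [i j] nij; rewrite coef_fpsM big1 // => e _ /=.
  have [i_s|/s0 Fi] := boolP (i \in s); last by rewrite Fi ?mul0r // -ltnS.
  have [j_t|/t0 Gj] := boolP (j \in t); last by rewrite Gj ?mulr0 // leq_subr.
  by case/negP: nij; apply: allpairs_f.
rewrite (eqfpsM (has_sum_le FS us s0) (has_sum_le GT ut t0)) //.
by rewrite big_allpairs big_distrlr /= coef_fps_sum; apply: eq_bigr => i _;
  rewrite coef_fps_sum.
Qed.

(** For each coefficient both sums are finite, and the projections of a common
    support give a box on which they can be exchanged. *)
Lemma has_sum_pair (I J : eqType) (F : I * J -> {fps R}) G S :
  fps_has_sum F S -> (forall i, fps_has_sum (fun j => F (i, j)) (G i)) ->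
  fps_has_sum G S.
Proof.
move=> FS FG; apply: has_sumP => d.
have [s us s0] := summable_le d (has_sum_summable FS).
pose s1 := undup (map fst s); pose s2 := undup (map snd s).
have s20 i j : j \notin s2 -> coef_fps (F (i, j)) d = 0.
  rewrite mem_undup => js; apply: s0 => //; apply: contraNN js => ijs.
  by apply/mapP; exists (i, j).
have s10 i j : i \notin s1 -> coef_fps (F (i, j)) d = 0.
  rewrite mem_undup => js; apply: s0 => //; apply: contraNN js => ijs.
  by apply/mapP; exists (i, j).
have Gd i : coef_fps (G i) d = \sum_(j <- s2) coef_fps (F (i, j)) d.
  by apply: has_sum_coef; rewrite ?undup_uniq //; apply: s20.
exists s1; split; rewrite ?undup_uniq //.
  by move=> i i_s; rewrite Gd big1 // => j _; apply: s10.
have -> : coef_fps S d =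
    \sum_(ij <- [seq (i, j) | i <- s1, j <- s2]) coef_fps (F ij) d.
  apply: has_sum_coef => //.
    by apply: allpairs_uniq; rewrite ?undup_uniq // => -[? ?] [? ?].
  move=> [i j] nij; have [i_s|/s10//] := boolP (i \in s1).
  have [j_s|/s20//] := boolP (j \in s2).
  by case/negP: nij; apply: allpairs_f.
by rewrite big_allpairs; apply: eq_bigr => i _; rewrite Gd.
Qed.

Lemma has_sum_finite (I : eqType) (F : I -> {fps R}) (s : seq I) :
  uniq s -> (forall i, i \notin s -> F i = 0) ->
  fps_has_sum F (\sum_(i <- s) F i).
Proof.
move=> us s0; apply: has_sumP => d; exists s; split=> //.
  by move=> i /s0->.
by rewrite coef_fps_sum.
Qed.

(** The uniform bound on the supports plays the role of domination: each
    coefficient of the sums is a finite sum over a list independent of n. *)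
Lemma has_sum_lim (I : eqType) (F : nat -> I -> {fps R}) G u l :
    (forall d, exists s : seq I, forall n i, i \notin s ->
       coef_fps (F n i) d = 0) ->
    (forall i, fps_cvg (F^~ i) (G i)) ->
    (forall n, fps_has_sum (F n) (u n)) -> fps_has_sum G l ->
  fps_cvg u l.
Proof.
move=> Fs FG Fu Gl d; have [s0 s00] := Fs d; pose s := undup s0.
have sF n i : i \notin s -> coef_fps (F n i) d = 0.
  by rewrite mem_undup; apply: s00.
have sG i : i \notin s -> coef_fps (G i) d = 0.
  by move=> /sF Fi; have [N FN] := FG i d; rewrite -(FN N).
have us : uniq s by rewrite undup_uniq.
have [N NF] : exists N, forall n, (N <= n)%N -> forall i, i \in s ->
    coef_fps (F n i) d = coef_fps (G i) d.
  elim: {sF sG us}s => [|i s [N IHN]]; first by exists 0%N.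
  have [M FM] := FG i d; exists (maxn N M) => n nNM j.
  by rewrite inE => /predU1P[->|js]; [apply: FM|apply: IHN]; rewrite ?js //; lia.
exists N => n /NF Fn.
rewrite (has_sum_coef (Fu n) us (sF n)) (has_sum_coef Gl us sG).
by apply: eq_big_seq.
Qed.

End Summation.

(** * The Jacobi triple product *)

Ltac gen_exp := repeat match goal with
  |- context [@GRing.exp ?T ?x ?n] => move: (@GRing.exp T x n) => ? end.

Section ReciprocalPochhammer.
Variable R : comUnitRingType.
Implicit Types p : {fps R}.

(** The value 0 at negative integers extends the recurrence rpochB1 to z = 0 and
    makes the ranges of summation implicit. *)
Definition rpoch p (z : int) : {fps R} :=
  if z is Posz n then (qpoch p p n)^-1 else 0.

Lemma rpoch_lt0 p (z : int) : z < 0 -> rpoch p z = 0.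
Proof. by case: z. Qed.

Lemma rpoch0 p : rpoch p 0 = 1.
Proof. by rewrite /= qpoch0 invr1. Qed.

Lemma rpochB1 p (z : int) : coef_fps p 0 = 0 -> 0 <= z ->
  rpoch p (z - 1) = (1 - p ^+ `|z|%N) * rpoch p z.
Proof.
case: z => // -[|n] p0 _; first by rewrite /= subrr mul0r.
have -> : n.+1%:Z - 1 = n by lia.
have u k : qpoch p p k \is a GRing.unit by apply: qpoch_unit.
have uw : 1 - p ^+ n.+1 \is a GRing.unit.
  by rewrite fps_unitE coef_fpsB coef_fps1 coef_fpsX_small ?subr0 ?unitr1.
by rewrite /= qpochS -exprS invrM // mulVKr.
Qed.

Lemma qpoch_oo_unit a p : coef_fps p 0 = 0 -> coef_fps a 0 = 0 ->
  qpoch_oo a p \is a GRing.unit.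
Proof.
move=> p0 a0; have := @qpochs_oo_unit R [:: a] p p0; rewrite /qpochs_oo big_seq1.
by apply=> b; rewrite inE => /eqP->.
Qed.

Lemma rpoch_cvg p (v : int) : coef_fps p 0 = 0 ->
  fps_cvg (fun n => rpoch p (n%:Z + v)) (qpoch_oo p p)^-1.
Proof.
move=> p0 d.
have uP n : qpoch p p n \is a GRing.unit by apply: qpoch_unit.
have [N NP] := fps_cvgV uP (qpoch_oo_unit p0 p0) (qpoch_cvg p p0) d.
exists (N + `|v|)%N => n nN.
have -> : n%:Z + v = absz (n%:Z + v) by lia.
by apply: NP; lia.
Qed.

End ReciprocalPochhammer.

(** The exponent K v (v - 1) / 2 + s v of the theta series of q^s in base q^K.
    It is nonnegative for 0 <= s <= K, and the subtraction is then exact. *)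
Definition theta_exp (K s : nat) (v : int) : nat :=
  match v with
  | Posz n => K * 'C(n, 2) + s * n
  | Negz n => K * 'C(n.+2, 2) - s * n.+1
  end.

Lemma theta_expE K s (v : int) : (s <= K)%N ->
  2 * (theta_exp K s v)%:Z = K%:Z * v * (v - 1) + 2 * s%:Z * v.
Proof.
have bin2E n : (2 * 'C(n, 2) = n * n.-1)%N.
  by elim: n => // n IHn; rewrite binS bin1; case: n IHn => [|n] //=; lia.
case: v => n sK /=; first by have := bin2E n; case: n => [|n] /=; nia.
have := bin2E n.+2; rewrite NegzE /= => h.
have : (s * n.+1 <= K * 'C(n.+2, 2))%N by apply: leq_mul => //; nia.
nia.
Qed.

(** Linear growth, which makes the theta series summable: for v > 0 the exponent
    is at least v (v - 1) / 2, and v -> - v exchanges s and K - s. *)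
Lemma theta_exp_ge K s (v : int) : (0 < K)%N -> (s <= K)%N ->
  (`|v| <= (theta_exp K s v).+1)%N.
Proof.
move=> K0 sK; have := theta_expE v sK.
have [v0 h|v0 h] := leP 0 v.
  have : 0 <= (K%:Z - 1) * (v * (v - 1)).
    by apply: mulr_ge0; [lia|case: v v0 {h} => // -[|n] _; nia].
  have : 0 <= s%:Z * v by apply: mulr_ge0.
  have : 0 <= (v - 1) * (v - 2) by case: v v0 {h} => // -[|[|n]] _; nia.
  nia.
have : 0 <= (K%:Z - s%:Z) * - v by apply: mulr_ge0; lia.
have : 0 <= (K%:Z - 1) * (v * (v + 1)) by apply: mulr_ge0; nia.
have : 0 <= (v + 1) * (v + 2) by case: v v0 {h} => // -[|[|n]] _; nia.
nia.
Qed.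

Definition int_ball (d : nat) : seq int :=
  [seq k%:Z - d%:Z | k <- iota 0 (d + d).+1].

Lemma mem_int_ball d (v : int) : (v \in int_ball d) = (`|v| <= d)%N.
Proof.
apply/mapP/idP => [[k]|vd]; first by rewrite mem_iota => kd ->; lia.
by exists (absz (v + d%:Z)%R); [rewrite mem_iota|]; lia.
Qed.

Section JacobiTriple.
Variable R : comUnitRingType.
Local Notation q := (fpsX R).

Lemma coef_fpsXn0 k : (0 < k)%N -> coef_fps (q ^+ k) 0 = 0.
Proof. by move=> k0; apply: coef_fpsX_small. Qed.

Lemma coef_fpsMXn_lt f k d : (d < k)%N -> coef_fps (f * q ^+ k) d = 0.
Proof. by move=> dk; rewrite mulrC coef_fpsXnM dk. Qed.

Lemma qpoch_fpsXS (s K n : nat) :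
  qpoch (q ^+ s) (q ^+ K) n.+1 = qpoch (q ^+ s) (q ^+ K) n * (1 - q ^+ (s + K * n)).
Proof. by rewrite qpochS -exprM -exprD. Qed.

(** Raising n by one multiplies both sides by 1 - q^(s + K n), by the Pascal rule
    for the q-binomial coefficients [m + n, m + v] and the shift v -> v + 1 in its
    second part; the symmetry v -> - v exchanges the roles of m and n. *)
Lemma finite_jacobi_triple (K s m n : nat) : (0 < K)%N -> (s <= K)%N ->
  fps_has_sum
    (fun v : int => (-1) ^+ `|v| * q ^+ theta_exp K s v *
       (qpoch (q ^+ K) (q ^+ K) (m + n) * rpoch (q ^+ K) (m%:Z + v)
          * rpoch (q ^+ K) (n%:Z - v)))
    (qpoch (q ^+ s) (q ^+ K) n * qpoch (q ^+ (K - s)) (q ^+ K) m).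
Proof.
move=> K0; have p0 := coef_fpsXn0 K0; set p := q ^+ K.
have step a b t S : (t <= K)%N ->
    fps_has_sum (fun v : int => (-1) ^+ `|v| * q ^+ theta_exp K t v *
       (qpoch p p (a + b) * rpoch p (a%:Z + v) * rpoch p (b%:Z - v))) S ->
    fps_has_sum (fun v : int => (-1) ^+ `|v| * q ^+ theta_exp K t v *
       (qpoch p p (a + b.+1) * rpoch p (a%:Z + v) * rpoch p (b.+1%:Z - v)))
      (S * (1 - q ^+ (t + K * b))).
  move=> tK FS; have := FS; set F := fun v => _ => FS1.
  pose G v := (-1) ^+ `|v| * q ^+ theta_exp K t v * (p ^+ (absz (b.+1%:Z - v)%R) *
    (qpoch p p (a + b) * rpoch p (a%:Z + v - 1) * rpoch p (b.+1%:Z - v))).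
  have GS : fps_has_sum G (- q ^+ (t + K * b) * S).
    apply/(has_sum_reindex (f := fun v => v + 1) (g := fun v => v - 1)).
    - exact: addrK.
    - by move=> v; rewrite subrK.
    apply: eq_has_sum (has_sumZ (- q ^+ (t + K * b)) FS1) => v; rewrite /G /F /=.
    have -> : a%:Z + (v + 1) - 1 = a%:Z + v by lia.
    have -> : b.+1%:Z - (v + 1) = b%:Z - v by lia.
    have [vb|vb] := leP v b;
      last by rewrite (@rpoch_lt0 _ _ (b%:Z - v)) ?subr_lt0 // !mulr0.
    (* The shift v -> v + 1 trades the factor p^(b - v) for a constant power. *)
    have E : (theta_exp K t (v + 1) + K * absz (b%:Z - v)%R = t + K * b
      + theta_exp K t v)%N.
      have := theta_expE v tK; have := theta_expE (v + 1) tK.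
      have : K%:Z * b%:Z = K%:Z * absz (b%:Z - v)%R + K%:Z * v.
        by rewrite -mulrDr; congr (_ * _); lia.
      by lia.
    have -> : (-1) ^+ (absz (v + 1)%R) = - (-1) ^+ `|v| :> {fps R}.
      rewrite -signr_odd -[in RHS]signr_odd.
      have -> : odd (absz (v + 1)%R) = ~~ odd `|v| by lia.
      by case: odd; rewrite ?expr1 ?expr0 ?opprK.
    rewrite /p -exprM !mulNr; congr (- _); apply: esym.
    transitivity ((-1) ^+ `|v| *
      (q ^+ theta_exp K t (v + 1) * q ^+ (K * absz (b%:Z - v)%R)) *
      (qpoch p p (a + b) * rpoch p (a%:Z + v) * rpoch p (b%:Z - v))).
      by rewrite /p; gen_exp; ring.
    rewrite -exprD E (exprD _ (t + K * b)) /p; gen_exp; ring.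
  have -> : S * (1 - q ^+ (t + K * b)) = S + - q ^+ (t + K * b) * S.
    by rewrite mulrBr mulr1 mulNr [S * _]mulrC.
  apply: eq_has_sum (has_sumD FS GS) => v; rewrite /G -mulrDr; congr (_ * _).
  have [va|va] := ltP (a%:Z + v) 0.
    by rewrite !(@rpoch_lt0 _ _ (a%:Z + v)) ?(@rpoch_lt0 _ _ (a%:Z + v - 1)) //;
      [rewrite !(mulr0, mul0r, addr0)|lia].
  have [vb|vb] := ltP (b.+1%:Z - v) 0.
    by rewrite !(@rpoch_lt0 _ _ (b.+1%:Z - v)) ?(@rpoch_lt0 _ _ (b%:Z - v)) //;
      [rewrite !(mulr0, mul0r, addr0)|lia].
  have -> : b%:Z - v = b.+1%:Z - v - 1 by lia.
  rewrite !rpochB1 // addnS qpochS -exprS.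
  have -> : (a + b).+1 = (absz (b.+1%:Z - v)%R + absz (a%:Z + v)%R)%N by lia.
  by rewrite exprD; gen_exp; ring.
have base t : (t <= K)%N ->
  fps_has_sum (fun v : int => (-1) ^+ `|v| * q ^+ theta_exp K t v *
       (qpoch p p (0 + 0) * rpoch p (0%:Z + v) * rpoch p (0%:Z - v))) 1.
  move=> tK.
  have := has_sum_finite (I := int) (F := fun v : int =>
    (-1) ^+ `|v| * q ^+ theta_exp K t v *
       (qpoch p p (0 + 0) * rpoch p (0%:Z + v) * rpoch p (0%:Z - v)))
         (s := [:: 0]) isT.
  rewrite big_seq1 subr0 rpoch0 qpoch0 /= !muln0 !expr0 !mulr1; apply=> v.
  rewrite inE sub0r add0r => v0.
  have [v1|v1] := ltP v 0; first by rewrite (@rpoch_lt0 _ _ v) // !(mulr0, mul0r).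
  by rewrite (@rpoch_lt0 _ _ (- v)) ?mulr0 //; lia.
have col t b : (t <= K)%N ->
  fps_has_sum (fun v : int => (-1) ^+ `|v| * q ^+ theta_exp K t v *
       (qpoch p p (0 + b) * rpoch p (0%:Z + v) * rpoch p (b%:Z - v)))
         (qpoch (q ^+ t) p b).
  move=> tK; elim: b => [|b IHb]; first by rewrite qpoch0; apply: base.
  by rewrite (qpoch_fpsXS t); apply: step.
move=> sK; elim: n => [|n IHn]; last first.
  by rewrite (qpoch_fpsXS s) mulrAC; apply: step.
rewrite qpoch0 mul1r; have := col (K - s)%N m (leq_subr _ _).
move/(has_sum_reindex (f := fun v => - v) (g := fun v => - v) _ (@opprK _)).
have h : (forall i : int, - - i <> i ->
  (fun v : int => (-1) ^+ `|v| * q ^+ theta_exp K (K - s) v *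
       (qpoch p p (0 + m) * rpoch p (0%:Z + v) * rpoch p (m%:Z - v))) i = 0).
  by move=> v; rewrite opprK.
move/(_ h); apply: eq_has_sum => v /=.
rewrite abszN; have -> : theta_exp K (K - s) (- v) = theta_exp K s v.
  have := theta_expE v sK; have := theta_expE (- v) (leq_subr s K).
  by rewrite -subzn //; lia.
by rewrite opprK addn0; congr (_ * _); apply: mulrAC.
Qed.

End JacobiTriple.

#[local] Opaque qpoch_oo.

Section TripleProduct.
Variable R : comUnitRingType.
Local Notation q := (fpsX R).

Lemma theta_exp_notin K s d (v : int) : (0 < K)%N -> (s <= K)%N ->
  v \notin int_ball d.+1 -> (d < theta_exp K s v)%N.
Proof. by move=> K0 sK; rewrite mem_int_ball; have := theta_exp_ge v K0 sK;
  lia. Qed.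

(** The limit m = n -> oo of the finite form, where each q-binomial coefficient
    tends to 1 / (p; p)_oo. *)
Theorem jacobi_triple_product (K s : nat) : (0 < K)%N -> (s <= K)%N ->
  fps_has_sum (fun v : int => (-1) ^+ `|v| * q ^+ theta_exp K s v)
    (qpoch_oo (q ^+ K) (q ^+ K)
       * (qpoch_oo (q ^+ s) (q ^+ K) * qpoch_oo (q ^+ (K - s)) (q ^+ K))).
Proof.
move=> K0 sK; have p0 := coef_fpsXn0 R K0; set p := q ^+ K.
set P := qpoch_oo p p; have uP : P \is a GRing.unit by apply: qpoch_oo_unit.
pose H (v : int) := (-1) ^+ `|v| * q ^+ theta_exp K s v * (P * P^-1 * P^-1).
have [L HL] : exists L, fps_has_sum H L.
  apply: summable_has_sum => d; exists (int_ball d.+1) => v nv.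
  by rewrite /H mulrAC coef_fpsMXn_lt // theta_exp_notin.
have LE : L = qpoch_oo (q ^+ s) p * qpoch_oo (q ^+ (K - s)) p.
  apply: (@fps_cvg_unique _ (fun n =>
    qpoch (q ^+ s) p n * qpoch (q ^+ (K - s)) p n)).
    apply: has_sum_lim HL => [d|v|n]; last exact: finite_jacobi_triple.
      exists (int_ball d.+1) => n v nv.
      by rewrite mulrAC coef_fpsMXn_lt // theta_exp_notin.
    apply: fps_cvgM; first exact: fps_cvg_cst.
    apply: fps_cvgM; last exact: (rpoch_cvg (- v) p0).
    apply: fps_cvgM; last exact: (rpoch_cvg v p0).
    by apply: (fps_cvg_sub (s := fun n => n + n)%N _ (qpoch_cvg p p0)) => n; lia.
  by apply: fps_cvgM; apply: qpoch_cvg.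
rewrite -LE; apply: eq_has_sum (has_sumZ P HL) => v.
by rewrite /H mulrV // mul1r mulrCA mulrV // mulr1.
Qed.

Lemma qpoch_dissect a p (m n : nat) :
  qpoch a p (m * n) = \prod_(r < m) qpoch (a * p ^+ r) (p ^+ m) n :> {fps R}.
Proof.
elim: n => [|n IHn]; first by rewrite muln0 qpoch0 big1 // => r _; rewrite qpoch0.
rewrite mulnS addnC /qpoch big_split_ord /= -/(qpoch a p _) IHn -big_split /=.
apply: eq_bigr => r _; rewrite big_ord_recr /=; congr (_ * (1 - _)).
by rewrite -mulrA -exprM -exprD addnC.
Qed.

(** The factors of the product are sorted by their index modulo m. *)
Lemma qpoch_oo_dissect a p m : (0 < m)%N -> coef_fps p 0 = 0 ->
  qpoch_oo a p = \prod_(r < m) qpoch_oo (a * p ^+ r) (p ^+ m) :> {fps R}.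
Proof.
move=> m0 p0; apply: (@fps_cvg_unique _ (fun n => qpoch a p (m * n))).
  by apply: (fps_cvg_sub (s := muln m) _ (qpoch_cvg a p0)) => n; rewrite leq_pmull.
have -> : (fun n => qpoch a p (m * n)) =
    (fun n => \prod_(r < m) qpoch (a * p ^+ r) (p ^+ m) n).
  by apply/funext => n; apply: qpoch_dissect.
by apply: fps_cvg_prod => r; apply: qpoch_cvg; rewrite coef_fpsX_small.
Qed.

Lemma signr_parity (m n : nat) : odd m = odd n -> (-1) ^+ m = (-1) ^+ n :> {fps R}.
Proof. by move=> mn; rewrite -signr_odd mn signr_odd. Qed.

End TripleProduct.

(** * The Macdonald identity of affine type A2 *)

Section Macdonald.
Variable R : comUnitRingType.
Local Notation q := (fpsX R).

Variables (K s0 s1 s2 : nat).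
Hypotheses (K0 : (0 < K)%N) (sK : (s0 + s1 + s2 = K)%N).

Local Notation P := (qpoch_oo (q ^+ K) (q ^+ K)).
Local Notation theta s :=
  (qpoch_oo (q ^+ s) (q ^+ K) * qpoch_oo (q ^+ (K - s)) (q ^+ K)).

(** Because s0 + s1 + s2 = K, a translation along the diagonal changes the
    exponent by a theta exponent in base q^(3 K) that depends on a + b + c only. *)
Lemma theta_exp_diag (sg : nat) (a b c t : int) :
    (sg < 3)%N -> a + b + c = sg ->
  (theta_exp K s0 (a + t) + theta_exp K s1 (b + t) + theta_exp K s2 (c + t)
   = theta_exp K s0 a + theta_exp K s1 b + theta_exp K s2 c
     + theta_exp (3 * K) (sg.+1 * K) t)%N.
Proof.
move=> sg2 abc; have sgK : (sg.+1 * K <= 3 * K)%N by rewrite leq_mul2r sg2 orbT.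
have [s0K s1K s2K] : [/\ s0 <= K, s1 <= K & s2 <= K]%N by split; lia.
have := theta_expE t sgK.
have := (theta_expE a s0K, theta_expE b s1K, theta_expE c s2K) => -[[]].
have := (theta_expE (a + t) s0K, theta_expE (b + t) s1K,
  theta_expE (c + t) s2K) => -[[]].
have -> : c = sg%:Z - a - b by lia.
have -> : s2%:Z = K%:Z - s0%:Z - s1%:Z by lia.
rewrite -[sg.+1]addn1 !PoszM !PoszD !mulrDl !mulrDr; lia.
Qed.

(** The Weyl group elements are encoded by the vectors (a, b, c) of Z^3 with
    a + b + c = 0 (even elements) or 1 (odd elements), given by this sum and by
    a and b. *)
Definition weyl_exp (v : bool * int * int) : nat :=
  let: (sg, a, b) := v in
  theta_exp K s0 a + theta_exp K s1 b + theta_exp K s2 (sg%:Z - a - b).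

(** Z^3 is the disjoint union of the diagonal lines through the vectors with
    coordinate sum 0, 1 or 2. Along such a line the product of the three theta
    series sums to the triple product D sg of base q^(3 K): it is (q^K; q^K)_oo
    for the sums 0 and 1 (the pentagonal number theorem), and 0 for the sum 2,
    where one of its factors is (1; q^(3 K))_oo. *)
Theorem macdonald_A2 :
  fps_has_sum (fun v : bool * int * int => (-1) ^+ v.1.1 * q ^+ weyl_exp v)
    (P ^+ 2 * (theta s0 * theta s1 * theta s2)).
Proof.
have p0 := coef_fpsXn0 R K0.
have uP : P \is a GRing.unit by apply: qpoch_oo_unit.
have [s0K s1K s2K] : [/\ s0 <= K, s1 <= K & s2 <= K]%N by split; lia.
have J3 := has_sumM (has_sumM (jacobi_triple_product R K0 s0K)
  (jacobi_triple_product R K0 s1K)) (jacobi_triple_product R K0 s2K).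
pose f (x : 'I_3 * int * int * int) :=
  let: (sg, a, b, t) := x in (a + t, b + t, sg%:Z - a - b + t).
pose g (y : int * int * int) : 'I_3 * int * int * int :=
  let: (a, b, c) := y in let t := ((a + b + c) %/ 3)%Z in
  (inord (absz ((a + b + c) %% 3)%Z), a - t, b - t, t).
have gK : cancel g f.
  move=> [[a b] c]; rewrite /f /g.
  set t := (_ %/ _)%Z; rewrite inordK; last by lia.
  by congr (_, _, _); lia.
have fK : cancel f g.
  move=> [[[sg a] b] t]; rewrite /f /g.
  have -> : a + t + (b + t) + (sg%:Z - a - b + t) = t * 3 + sg by lia.
  have sg3 := ltn_ord sg.
  have -> : ((t * 3 + sg) %/ 3)%Z = t by lia.
  have -> : absz ((t * 3 + sg) %% 3)%Z = sg by lia.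
  by rewrite inord_val !addrK.
have F0 F : forall i, f (g i) <> i -> F i = 0 :> {fps R} by move=> i; rewrite gK.
move/(has_sum_reindex _ fK (F0 _)): J3 => J3.
pose D sg := qpoch_oo (q ^+ (3 * K)) (q ^+ (3 * K)) *
  (qpoch_oo (q ^+ (sg.+1 * K)) (q ^+ (3 * K))
   * qpoch_oo (q ^+ (3 * K - sg.+1 * K)) (q ^+ (3 * K))).
pose e (v : 'I_3 * int * int) := let: (sg, a, b) := v in
  (theta_exp K s0 a + theta_exp K s1 b + theta_exp K s2 (sg%:Z - a - b))%N.
pose G (v : 'I_3 * int * int) : {fps R} := (-1) ^+ v.1.1 * q ^+ e v * D v.1.1.
have D2 : D 2%N = 0.
  rewrite /D subnn expr0.
  have -> : qpoch_oo 1 (q ^+ (3 * K)) = 0 :> {fps R}.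
    apply: fps_cvg_lim => d; exists 1%N => -[//|n] _.
    by rewrite /qpoch big_ord_recl expr0 mulr1 subrr mul0r.
  by rewrite !mulr0.
have D01 sg : (sg < 2)%N -> D sg = P.
  have e1 r : q ^+ K * q ^+ K ^+ r = q ^+ (r.+1 * K) by rewrite -exprS -exprM mulnC.
  have := qpoch_oo_dissect (q ^+ K) (isT : 0 < 3)%N p0.
  rewrite 3!big_ord_recl big_ord0 mulr1 !e1 -exprM [(K * 3)%N]mulnC => ->.
  rewrite /D -mulnBl; case: sg => [|[|//]] _; rewrite mulrC.
    by rewrite -mulrA.
  by rewrite [X in X * _]mulrC -mulrA.
move: J3; set S3 := (X in fps_has_sum _ X -> _) => J3.
have S3E : P^-1 * S3 = P ^+ 2 * (theta s0 * theta s1 * theta s2).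
  rewrite /S3; move: (theta s0) (theta s1) (theta s2) P uP => t0 t1 t2 p3 up3.
  by apply: (mulrI up3); rewrite mulVKr //; ring.
clearbody S3.
have : fps_has_sum G S3.
  apply: has_sum_pair J3 _ => -[[sg a] b]; rewrite /G /=; have sg3 := ltn_ord sg.
  have K30 : (0 < 3 * K)%N by lia.
  have sgK : (sg.+1 * K <= 3 * K)%N by rewrite leq_mul2r ltn_ord orbT.
  apply: eq_has_sum (has_sumZ _ (jacobi_triple_product R K30 sgK)) => t /=.
  have sabc : a + b + (sg%:Z - a - b) = sg by lia.
  have := theta_exp_diag t sg3 sabc.
  set ea := theta_exp K s0 _; set eb := theta_exp K s1 _.
  set ec := theta_exp K s2 _ => E.
  transitivity ((-1) ^+ (sg + absz t) * q ^+ (ea + eb + ec)).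
    by rewrite E !exprD; gen_exp; ring.
  have -> : (-1) ^+ (sg + absz t)
    = (-1) ^+ (absz (a + t)%R + absz (b + t)%R + absz (sg%:Z - a - b + t)%R)
    :> {fps R}.
    by apply: signr_parity; lia.
  by rewrite !exprD; gen_exp; ring.
clearbody D.
pose h (v : bool * int * int) : 'I_3 * int * int :=
  let: (sg, a, b) := v in (inord sg, a, b).
pose k (v : 'I_3 * int * int) : bool * int * int :=
  let: (sg, a, b) := v in (sg == 1%N :> nat, a, b).
have hK : cancel h k by move=> [[[] a] b] /=; rewrite inordK.
have G0 v : h (k v) <> v -> G v = 0.
  case: v => -[[[|[|[|//]]] sg3] a] b; rewrite /G /= ?D2 ?mulr0 // => -[];
    by congr (_, _, _); apply: val_inj; rewrite /= inordK.
move/(has_sum_reindex _ hK G0)/(has_sumZ P^-1).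
rewrite S3E.
apply: eq_has_sum => -[[sg a] b]; rewrite /G /=.
have sgE : (inord sg : 'I_3) = sg :> nat by rewrite inordK //; case: (sg).
rewrite sgE D01; last by case: (sg).
by move: P uP => p3 up3; rewrite mulrCA mulVr // mulr1.
Qed.

End Macdonald.

(** * Alternating sums for cylindric partitions of rank 3 *)

Section CylindricSum.
Local Notation q := (fpsX int).
Local Notation r := (rpoch q).

Let q0 : coef_fps q 0 = 0. Proof. by []. Qed.

#[local] Arguments weyl_exp : simpl never.

(** Over the integers, where linear arithmetic can compare two exponents. *)
Lemma weyl_expE K s0 s1 s2 (v : bool * int * int) :
    (s0 <= K)%N -> (s1 <= K)%N -> (s2 <= K)%N ->
  let: (sg, a, b) := v in let c := sg%:Z - a - b in
  2 * (weyl_exp K s0 s1 s2 v)%:Z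
  = K%:Z * (a * (a - 1) + b * (b - 1) + c * (c - 1))
    + 2 * (s0%:Z * a + s1%:Z * b + s2%:Z * c).
Proof.
case: v => -[sg a] b s0K s1K s2K; rewrite /weyl_exp !PoszD !mulrDr.
by rewrite !theta_expE //; ring.
Qed.

Definition weyl_box d : seq (bool * int * int) :=
  [seq (sg, b) | sg <- [seq (sg, a) | sg <- [:: true; false], a <- int_ball d.+1],
                 b <- int_ball d.+1].

Lemma weyl_exp_notin K s0 s1 s2 d v : (0 < K)%N -> (s0 <= K)%N -> (s1 <= K)%N ->
  v \notin weyl_box d -> (d < weyl_exp K s0 s1 s2 v)%N.
Proof.
case: v => -[sg a] b K0 s0K s1K nv; rewrite /weyl_exp.
have [ad|/(theta_exp_notin K0 s0K)] := boolP (a \in int_ball d.+1); last by lia.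
have [bd|/(theta_exp_notin K0 s1K)] := boolP (b \in int_ball d.+1); last by lia.
by case/negP: nv; apply: allpairs_f => //; apply: allpairs_f => //; case: (sg).
Qed.

(** The term of a Weyl group element in the alternating sum for the cylindric
    partitions of profile (s0 - 1, s1 - 1, s2 - 1) with parts at most N. *)
Definition cyl_term (s0 s1 s2 : nat) (N : int) (v : bool * int * int) : {fps int} :=
  let: (sg, a, b) := v in let c := sg%:Z - a - b in
  (-1) ^+ sg * q ^+ weyl_exp (s0 + s1 + s2) s0 s1 s2 v
    * (r (N + b - a) * r (N + c - b) * r (N + a - c)).

Definition cyl_sum s0 s1 s2 N := fps_sum (cyl_term s0 s1 s2 N).

Lemma cyl_term_notin s0 s1 s2 N d v : (0 < s0 + s1 + s2)%N ->
  v \notin weyl_box d -> coef_fps (cyl_term s0 s1 s2 N v) d = 0.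
Proof.
move=> s_gt0 nv; have := nv; case: v nv => -[sg a] b nv nv'.
by rewrite /cyl_term mulrAC coef_fpsMXn_lt // weyl_exp_notin //; lia.
Qed.

Lemma cyl_sumP s0 s1 s2 N : (0 < s0 + s1 + s2)%N ->
  fps_has_sum (cyl_term s0 s1 s2 N) (cyl_sum s0 s1 s2 N).
Proof.
move=> s_gt0; apply: fps_sumP => d; exists (weyl_box d) => v.
exact: cyl_term_notin.
Qed.

(** The cyclic rotation of (a, b, c) is a symmetry of the Weyl group. *)
Lemma cyl_sum_rot s0 s1 s2 N : (0 < s0 + s1 + s2)%N ->
  cyl_sum s1 s2 s0 N = cyl_sum s0 s1 s2 N.
Proof.
move=> s_gt0; apply: fps_sumE.
pose f (v : bool * int * int) : bool * int * int :=
  let: (sg, a, b) := v in (sg, sg%:Z - a - b, a).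
pose g (v : bool * int * int) : bool * int * int :=
  let: (sg, a, b) := v in (sg, b, sg%:Z - a - b).
have fK : cancel f g by move=> [[sg a] b]; congr (_, _, _); lia.
have gK v : f (g v) <> v -> cyl_term s0 s1 s2 N v = 0.
  by case: v => -[sg a] b []; congr (_, _, _); lia.
apply: eq_has_sum (iffLR (has_sum_reindex _ fK gK) (cyl_sumP N s_gt0)).
move=> [[sg a] b]; rewrite /cyl_term /=.
rewrite /weyl_exp; have -> : sg%:Z - (sg%:Z - a - b) - a = b by lia.
have -> : (s1 + s2 + s0 = s0 + s1 + s2)%N by lia.
congr (_ * q ^+ _ * _); first by lia.
by move: (r _) (r _) (r _) => *; ring.
Qed.

(** Multiplying the term of s at N by the three factors 1 - q^(N + y) gives
    the term at N - 1, since 1 / (q; q)_(N + y) becomes 1 / (q; q)_(N + y - 1).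
    Expanding the product, the factor q^(y_i) has the effect of moving one unit
    from s_i to s_(i + 1): the eight subsets of the three factors give the
    eight sums at N. *)
Lemma cyl_sumB1 s0 s1 s2 (N : nat) :
  let A t0 t1 t2 := cyl_sum t0 t1 t2 N in
  cyl_sum s0.+1 s1.+1 s2.+1 (N%:Z - 1) =
    A s0.+1 s1.+1 s2.+1
    - q ^+ N * (A s0 s1.+2 s2.+1 + A s0.+1 s1 s2.+2 + A s0.+2 s1.+1 s2)
    + q ^+ (2 * N) * (A s0 s1.+1 s2.+2 + A s0.+2 s1 s2.+1 + A s0.+1 s1.+2 s2)
    - q ^+ (3 * N) * A s0.+1 s1.+1 s2.+1.
Proof.
move=> A; apply: fps_sumE.
have AP t0 t1 t2 : (0 < t0 + t1 + t2)%N ->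
  fps_has_sum (cyl_term t0 t1 t2 N) (A t0 t1 t2).
  exact: cyl_sumP.
apply: eq_has_sum (has_sumD (has_sumD (has_sumD (AP s0.+1 s1.+1 s2.+1 _)
  (has_sumN (has_sumZ (q ^+ N) (has_sumD (has_sumD (AP s0 s1.+2 s2.+1 _)
     (AP s0.+1 s1 s2.+2 _)) (AP s0.+2 s1.+1 s2 _)))))
  (has_sumZ (q ^+ (2 * N)) (has_sumD (has_sumD (AP s0 s1.+1 s2.+2 _)
     (AP s0.+2 s1 s2.+1 _)) (AP s0.+1 s1.+2 s2 _))))
  (has_sumN (has_sumZ (q ^+ (3 * N)) (AP s0.+1 s1.+1 s2.+1 _)))); try lia.
move=> {A AP} [[sg a] b]; rewrite /cyl_term.
set c := sg%:Z - a - b.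
have e t0 t1 t2 := @weyl_expE (t0 + t1 + t2) t0 t1 t2 (sg, a, b).
move: e; rewrite -/c => e.
have [y0|y0] := ltP (N%:Z + b - a) 0.
  by rewrite !(@rpoch_lt0 _ _ (N%:Z + b - a))
    ?(@rpoch_lt0 _ _ (N%:Z - 1 + b - a)) ?(mulr0, mul0r, addr0, subr0) //; lia.
have [y1|y1] := ltP (N%:Z + c - b) 0.
  by rewrite !(@rpoch_lt0 _ _ (N%:Z + c - b))
    ?(@rpoch_lt0 _ _ (N%:Z - 1 + c - b)) ?(mulr0, mul0r, addr0, subr0) //; lia.
have [y2|y2] := ltP (N%:Z + a - c) 0.
  by rewrite !(@rpoch_lt0 _ _ (N%:Z + a - c))
    ?(@rpoch_lt0 _ _ (N%:Z - 1 + a - c)) ?(mulr0, mul0r, addr0, subr0) //; lia.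
have -> : N%:Z - 1 + b - a = N%:Z + b - a - 1 by lia.
have -> : N%:Z - 1 + c - b = N%:Z + c - b - 1 by lia.
have -> : N%:Z - 1 + a - c = N%:Z + a - c - 1 by lia.
rewrite !rpochB1 //.
move: (r _) (r _) (r _) => r2 r1 r0.
set n0 := absz (N%:Z + b - a)%R; set n1 := absz (N%:Z + c - b)%R.
set n2 := absz (N%:Z + a - c)%R.
pose E t0 t1 t2 := weyl_exp (t0 + t1 + t2) t0 t1 t2 (sg, a, b).
have E0 : (E s0.+1 s1.+1 s2.+1 + n0 = N + E s0 s1.+2 s2.+1)%N.
  by rewrite /E; have := e s0.+1 s1.+1 s2.+1; have := e s0 s1.+2 s2.+1; lia.
have E1 : (E s0.+1 s1.+1 s2.+1 + n1 = N + E s0.+1 s1 s2.+2)%N.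
  by rewrite /E; have := e s0.+1 s1.+1 s2.+1; have := e s0.+1 s1 s2.+2; lia.
have E2 : (E s0.+1 s1.+1 s2.+1 + n2 = N + E s0.+2 s1.+1 s2)%N.
  by rewrite /E; have := e s0.+1 s1.+1 s2.+1; have := e s0.+2 s1.+1 s2; lia.
have E01 : (E s0.+1 s1.+1 s2.+1 + n0 + n1 = 2 * N + E s0 s1.+1 s2.+2)%N.
  by rewrite /E; have := e s0.+1 s1.+1 s2.+1; have := e s0 s1.+1 s2.+2; lia.
have E12 : (E s0.+1 s1.+1 s2.+1 + n1 + n2 = 2 * N + E s0.+2 s1 s2.+1)%N.
  by rewrite /E; have := e s0.+1 s1.+1 s2.+1; have := e s0.+2 s1 s2.+1; lia.
have E02 : (E s0.+1 s1.+1 s2.+1 + n0 + n2 = 2 * N + E s0.+1 s1.+2 s2)%N.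
  by rewrite /E; have := e s0.+1 s1.+1 s2.+1; have := e s0.+1 s1.+2 s2; lia.
have E012 : (n0 + n1 + n2 = 3 * N)%N by lia.
have X (k l m n : nat) : (k + l = m + n)%N -> q ^+ k * q ^+ l = q ^+ m * q ^+ n.
  by rewrite -!exprD => ->.
have {}E01 := X _ (n0 + n1)%N _ _ (etrans (addnA _ _ _) E01).
have {}E12 := X _ (n1 + n2)%N _ _ (etrans (addnA _ _ _) E12).
have {}E02 := X _ (n0 + n2)%N _ _ (etrans (addnA _ _ _) E02).
have {}E0 := X _ _ _ _ E0; have {}E1 := X _ _ _ _ E1; have {}E2 := X _ _ _ _ E2.
have EE t0 t1 t2 : weyl_exp (t0 + t1 + t2) t0 t1 t2 (sg, a, b) = E t0 t1 t2 by [].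
rewrite !{}EE; clearbody E; set w := E s0.+1 s1.+1 s2.+1 in E0 E1 E2 E01 E12 E02 *.
apply: esym; transitivity
  ((-1) ^+ sg * (q ^+ w - q ^+ w * q ^+ n0 - q ^+ w * q ^+ n1
    - q ^+ w * q ^+ n2 + q ^+ w * q ^+ (n0 + n1) + q ^+ w * q ^+ (n1 + n2)
    + q ^+ w * q ^+ (n0 + n2) - q ^+ w * q ^+ (n0 + n1 + n2)) * (r0 * r1 * r2)).
  by rewrite !exprD; gen_exp; ring.
rewrite E0 E1 E2 E01 E12 E02 E012; gen_exp; ring.
Qed.

(** In the difference of the two sides the factor 1 - q^(N + b - a) turns
    1 / (q; q)_(N + b - a) into 1 / (q; q)_(N + b - a - 1). The three denominators
    are then permuted by the reflection (a, b, c) -> (-c, 1 - b, -a), which keeps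
    the exponent because s1 = 0 and changes the sign: the terms cancel in pairs. *)
Lemma cyl_sum_wall s0 s2 (N : nat) :
  cyl_sum s0.+1 0 s2 N = q ^+ N * cyl_sum s0 1 s2 N.
Proof.
have AP t0 t1 t2 : (0 < t0 + t1 + t2)%N ->
    fps_has_sum (cyl_term t0 t1 t2 N) (cyl_sum t0 t1 t2 N).
  exact: cyl_sumP.
apply/eqP; rewrite -subr_eq0; apply/eqP; set S := _ - _.
pose D (v : bool * int * int) : {fps int} := let: (sg, a, b) := v in
  let c := sg%:Z - a - b in
  (-1) ^+ sg * q ^+ weyl_exp (s0.+1 + 0 + s2) s0.+1 0 s2 v
    * (r (N%:Z + b - a - 1) * r (N%:Z + c - b) * r (N%:Z + a - c)).
have DS : fps_has_sum D S.
  apply: eq_has_sum (has_sumD (AP s0.+1 0%N s2 _)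
    (has_sumN (has_sumZ (q ^+ N) (AP s0 1%N s2 _)))); try lia.
  move=> [[sg a] b]; rewrite /cyl_term /D; set c := sg%:Z - a - b.
  have [y0|y0] := ltP (N%:Z + b - a) 0.
    by rewrite !(@rpoch_lt0 _ _ (N%:Z + b - a))
      ?(@rpoch_lt0 _ _ (N%:Z + b - a - 1)) ?(mulr0, mul0r, addr0, subr0) //; lia.
  rewrite rpochB1 //.
  have e t0 t1 t2 := @weyl_expE (t0 + t1 + t2) t0 t1 t2 (sg, a, b).
  have E : (N + weyl_exp (s0 + 1 + s2) s0 1 s2 (sg, a, b) =
      weyl_exp (s0.+1 + 0 + s2) s0.+1 0 s2 (sg, a, b) + absz (N%:Z + b - a)%R)%N.
    by have := e s0.+1 0%N s2; have := e s0 1%N s2; lia.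
  move: (r _) (r _) (r _) => r2 r1 r0.
  rewrite [q ^+ N * _]mulrA [q ^+ N * _]mulrCA -exprD E exprD; gen_exp; ring.
pose i (v : bool * int * int) : bool * int * int :=
  let: (sg, a, b) := v in (~~ sg, a + b - sg%:Z, 1 - b).
have iK : involutive i.
  by move=> [[sg a] b]; rewrite /i negbK; congr (_, _, _); case: sg; lia.
have i0 v : i (i v) <> v -> D v = 0 by rewrite iK.
have DN : fps_has_sum D (- S).
  have := has_sumN (iffLR (has_sum_reindex _ iK i0) DS).
  apply: eq_has_sum => -[[sg a] b]; rewrite /D /=.
  set c := sg%:Z - a - b; set a' := a + b - sg%:Z; set b' := 1 - b.
  set c' := (~~ sg)%:Z - a' - b'.
  have -> : N%:Z + b' - a' - 1 = N%:Z + c - b by rewrite /a' /b' /c; lia.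
  have -> : N%:Z + c' - b' = N%:Z + b - a - 1 by rewrite /c' /a' /b';
    case: (sg); lia.
  have -> : N%:Z + a' - c' = N%:Z + a - c by rewrite /c' /a' /b' /c;
    case: (sg); lia.
  have -> : weyl_exp (s0.+1 + 0 + s2) s0.+1 0 s2 (~~ sg, a', b') =
            weyl_exp (s0.+1 + 0 + s2) s0.+1 0 s2 (sg, a, b).
    have e v := @weyl_expE (s0.+1 + 0 + s2) s0.+1 0 s2 v.
    have := e (~~ sg, a', b'); have := e (sg, a, b).
    by rewrite /a' /b'; case: (sg) => /=; lia.
  have -> : (-1) ^+ (~~ sg) = - (-1) ^+ sg :> {fps int}.
    by case: (sg); rewrite ?expr0 ?expr1 ?opprK.
  move: (r _) (r _) (r _) => r2 r1 r0; gen_exp; ring.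
apply: fpsP => d; have SN : coef_fps S d = - coef_fps S d.
  by rewrite -coef_fpsN -(fps_has_sum_unique DS DN).
by rewrite coef_fps0; clearbody S; lia.
Qed.

(** The three arguments of r add up to 0, so that one of them is negative unless
    a = b = c. *)
Lemma cyl_sum0 s0 s1 s2 : (0 < s0 + s1 + s2)%N -> cyl_sum s0 s1 s2 0 = 1.
Proof.
move=> s_gt0; apply: fps_sumE.
have := has_sum_finite (F := cyl_term s0 s1 s2 0) (s := [:: (false, 0, 0)]) isT.
have -> : \sum_(v <- [:: (false, 0, 0)]) cyl_term s0 s1 s2 0 v = 1.
  by rewrite big_seq1 /cyl_term !subr0 rpoch0 !mulr1 mul1r /weyl_exp subr0 /=
    !muln0.
apply=> -[[sg a] b] nv; rewrite /cyl_term; set c := sg%:Z - a - b.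
have [y0|y0] := ltP (0 + b - a) 0;
  first by rewrite (@rpoch_lt0 _ _ (0 + b - a)) // !(mulr0, mul0r).
have [y1|y1] := ltP (0 + c - b) 0;
  first by rewrite (@rpoch_lt0 _ _ (0 + c - b)) // !(mulr0, mul0r).
have [y2|y2] := ltP (0 + a - c) 0;
  first by rewrite (@rpoch_lt0 _ _ (0 + a - c)) // !(mulr0, mul0r).
case/negP: nv; have a0 : a = 0 by move: y0 y1 y2; rewrite /c; case: (sg); lia.
have b0 : b = 0 by move: y0 y1 y2; rewrite /c; case: (sg); lia.
by move: y0 y1 y2; rewrite /c a0 b0; case: (sg).
Qed.

(** This makes the recurrence cyl_sumB1 hold at N = 0 with the value 0 on the
    left, as the generating series in z require. *)
Lemma cyl_sumN1 s0 s1 s2 : cyl_sum s0 s1 s2 (- 1) = 0.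
Proof.
apply: fps_sumE; have :=
  has_sum_finite (F := cyl_term s0 s1 s2 (- 1)) (s := [::]) isT.
rewrite big_nil; apply=> -[[sg a] b] _; rewrite /cyl_term; set c := sg%:Z - a - b.
have [y0|y0] := ltP (- 1 + b - a) 0;
  first by rewrite (@rpoch_lt0 _ _ (- 1 + b - a)) // !(mulr0, mul0r).
have [y1|y1] := ltP (- 1 + c - b) 0;
  first by rewrite (@rpoch_lt0 _ _ (- 1 + c - b)) // !(mulr0, mul0r).
by rewrite (@rpoch_lt0 _ _ (- 1 + a - c)) ?(mulr0, mul0r) //; lia.
Qed.

(** Each of the three factors r tends to 1 / (q; q)_oo. *)
Lemma cyl_sum_lim K s0 s1 s2 L : (0 < K)%N -> (s0 + s1 + s2 = K)%N ->
  fps_has_sum (fun v : bool * int * int =>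
    (-1) ^+ v.1.1 * q ^+ weyl_exp K s0 s1 s2 v) L ->
  fps_cvg (fun N : nat => cyl_sum s0 s1 s2 N) ((qpoch_oo q q)^-1 ^+ 3 * L).
Proof.
move=> K_gt0 sK /(has_sumZ ((qpoch_oo q q)^-1 ^+ 3)) M.
apply: (has_sum_lim (F := fun N : nat => cyl_term s0 s1 s2 N) _ _ _ M) => [d|v|N].
- by exists (weyl_box d) => N v; apply: cyl_term_notin; lia.
- case: v => -[sg a] b; rewrite /cyl_term sK [_ ^+ 3 * _]mulrC.
  apply: fps_cvgM; first exact: fps_cvg_cst.
  have C (y : int) := rpoch_cvg y q0.
  have E : (qpoch_oo q q)^-1 ^+ 3
    = (qpoch_oo q q)^-1 * (qpoch_oo q q)^-1 * (qpoch_oo q q)^-1.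
    by move: (_^-1) => x; ring.
  rewrite E; set c := sg%:Z - a - b.
  have D x y : (fun N : nat => r (N%:Z + x - y))
    = (fun N : nat => r (N%:Z + (x - y))).
    by apply/funext => N; rewrite addrA.
  by apply: fps_cvgM; first apply: fps_cvgM; rewrite D; apply: C.
- by apply: cyl_sumP; lia.
Qed.

End CylindricSum.

(** * Contiguous relations between the multiple sums *)

(** 1 / (q; q)_(n - m), and 0 for m > n: the summand below is a product of these,
    and all recurrences reduce to the three lemmas on rfact. *)
Definition rfact (n m : nat) : {fps int} :=
  if (m <= n)%N then (qpoch (fpsX int) (fpsX int) (n - m))^-1 else 0.

Ltac ring_atoms := gen_exp; repeat match goal with
  | |- context [rfact ?n ?m] => move: (rfact n m) => ?
  | |- context [@qpoch ?T ?a ?p ?n] => move: (@qpoch T a p n) => ?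
  end; ring.

Section MultiSum.
Local Notation q := (fpsX int).

Lemma qfact_unit n : qpoch q q n \is a GRing.unit.
Proof. exact: qpoch_unit. Qed.

Lemma qfactS n : qpoch q q n.+1 = qpoch q q n * (1 - q ^+ n.+1).
Proof. by rewrite qpochS -exprS. Qed.

Lemma rfact_out n m : (n < m)%N -> rfact n m = 0.
Proof. by rewrite /rfact ltnNge => /negbTE->. Qed.

Lemma rfactSS n m : rfact n.+1 m.+1 = rfact n m.
Proof. by []. Qed.

Lemma rfactSl n m : rfact n.+1 m * (1 - q ^+ (n.+1 - m)) = rfact n m.
Proof.
have [mn|nm] := leqP m n; last first.
  rewrite (rfact_out nm); have [->|mn] := eqVneq m n.+1;
    first by rewrite subnn subrr mulr0.
  by rewrite rfact_out ?mul0r // ltn_neqAle eq_sym mn.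
rewrite /rfact (leqW mn) mn subSn // qfactS.
have u : 1 - q ^+ (n - m).+1 \is a GRing.unit.
  by rewrite fps_unitE coef_fpsB coef_fps1 coef_fpsX_small ?subr0 ?unitr1.
by rewrite invrM ?qfact_unit // mulrAC mulVr ?mul1r.
Qed.

Lemma rfactSr n m : rfact n m.+1 = rfact n m * (1 - q ^+ (n - m)).
Proof. by rewrite -(rfactSl n m.+1) subSS rfactSS. Qed.

(** The quadratic form for (n1, n2, n3, n4) = (n, m, j, k); the term is 0 when the
    subtraction truncates. *)
Definition msum_exp n m j k := (n * (n - m) + m ^ 2 + j ^ 2 + k ^ 2 + m * k)%N.

Definition msum_term b c d n m j k : {fps int} :=
  q ^+ (msum_exp n m j k + b * m + c * j + d * k)
  * (qpoch q q n * (rfact n m * rfact n k * rfact m j * rfact k 0 * rfact j 0)).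

Definition msum_coef b c d n :=
  \sum_(m < n.+1) \sum_(j < n.+1) \sum_(k < n.+1) msum_term b c d n m j k.

(** The multiple sum with n1, n2, n3, n4 weighted by a, b, c, d and z^n1 inserted.
    Raising a by one is the substitution z -> z q. *)
Definition msum a b c d : {fps {fps int}} :=
  FPS (fun n => q ^+ (a * n) * msum_coef b c d n).

Lemma big_ord_trunc (F : nat -> {fps int}) (m n : nat) : (m <= n)%N ->
  (forall k, (m <= k)%N -> F k = 0) -> \sum_(k < n) F k = \sum_(k < m) F k.
Proof.
move=> mn F0; rewrite -!(big_mkord xpredT F) (big_cat_nat (n := m)) //=.
by rewrite [X in _ + X]big_nat [X in _ + X]big1 ?addr0 // => k /andP[mk _];
  exact: F0.
Qed.

Lemma msum_coef_widen b c d n B : (n < B)%N ->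
  msum_coef b c d n =
  \sum_(m < B) \sum_(j < B) \sum_(k < B) msum_term b c d n m j k.
Proof.
move=> nB; have k0 m j k : (n < k)%N -> msum_term b c d n m j k = 0.
  by move=> nk; rewrite /msum_term (rfact_out nk) !(mulr0, mul0r).
have j0 m j k : (n < j)%N -> msum_term b c d n m j k = 0.
  have [mn|nm] := leqP m n => nj.
    by rewrite /msum_term (rfact_out (leq_ltn_trans mn nj)) !(mulr0, mul0r).
  by rewrite /msum_term (rfact_out nm) !(mulr0, mul0r).
have m0 m j k : (n < m)%N -> msum_term b c d n m j k = 0.
  by move=> nm; rewrite /msum_term (rfact_out nm) !(mulr0, mul0r).
rewrite [RHS](big_ord_trunc (m := n.+1) (F := fun m =>
  \sum_(j < B) \sum_(k < B) msum_term b c d n m j k)) //; last first.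
  by move=> m nm; rewrite big1 // => j _; rewrite big1 // => k _; apply: m0.
apply: eq_bigr => m _; rewrite
  [RHS](big_ord_trunc (m := n.+1) (F := fun j =>
  \sum_(k < B) msum_term b c d n m j k)) //; last first.
  by move=> j nj; rewrite big1 // => k _; apply: j0.
apply: eq_bigr => j _; rewrite
  [RHS](big_ord_trunc (m := n.+1) (F := fun k => msum_term b c d n m j k)) //.
exact: k0.
Qed.

Lemma sum_shift (F G : nat -> {fps int}) B :
  F 0%N = 0 -> F B = 0 -> (forall k, F k.+1 = G k) ->
  \sum_(k < B) F k = \sum_(k < B) G k.
Proof.
move=> F0 FB FG; have : \sum_(k < B.+1) F k = \sum_(k < B.+1) F k by [].
rewrite {1}big_ord_recr big_ord_recl /= F0 FB addr0 add0r => ->.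
by apply: eq_bigr => k _; rewrite FG.
Qed.

Lemma qexp_eq (k l : nat) : k = l -> q ^+ k = q ^+ l.
Proof. by move->. Qed.

(** The three shift relations compare the sum of the terms multiplied by
    1 - q^n4 (resp. 1 - q^n3, 1 - q^(n2 - n3)) with itself after the index n4
    (resp. n3, n2) has been raised by one: the factor cancels against a
    q-factorial. *)
Lemma msum_coef_shift_n4 b c d n :
  msum_coef b c d n - msum_coef b c d.+1 n
  = q ^+ d.+1 * (msum_coef b.+1 c d.+2 n - q ^+ n * msum_coef b.+1 c d.+1 n).
Proof.
rewrite /msum_coef [q ^+ n * _]mulr_sumr -!sumrB mulr_sumr; apply: eq_bigr => m _.
rewrite [q ^+ n * _]mulr_sumr -!sumrB mulr_sumr; apply: eq_bigr => j _.
rewrite [q ^+ n * _]mulr_sumr -!sumrB mulr_sumr.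
apply: (sum_shift (F := fun k =>
  msum_term b c d n m j k - msum_term b c d.+1 n m j k)
  (G := fun k => q ^+ d.+1 * (msum_term b.+1 c d.+2 n m j k
                              - q ^+ n * msum_term b.+1 c d.+1 n m j k))) => [||k].
- by rewrite /msum_term !muln0 subrr.
- by rewrite /msum_term (rfact_out (ltnSn n)) !(mulr0, mul0r) subr0.
rewrite /msum_term rfactSr -(rfactSl k 0) subn0.
have [kn|/rfact_out->] := leqP k n; last by rewrite !(mulr0, mul0r) ?(subrr, mulr0).
(* H2, H3 and H4 compare the exponents of the four terms. *)
set E1 := (_ + _ + _ + d * k.+1)%N; set E2 := (_ + _ + _ + d.+1 * k.+1)%N.
set E3 := (_ + _ + _ + d.+2 * k)%N; set E4 := (_ + _ + _ + d.+1 * k)%N.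
have H2 : q ^+ E2 = q ^+ E1 * q ^+ k.+1 by rewrite -exprD; apply: qexp_eq;
  rewrite /E1 /E2; lia.
have H3 : q ^+ d.+1 * q ^+ E3 = q ^+ E1.
  by rewrite -exprD; apply: qexp_eq; rewrite /E1 /E3 /msum_exp; lia.
have H4 : q ^+ d.+1 * q ^+ n * q ^+ E4 = q ^+ E1 * q ^+ (n - k).
  by rewrite -!exprD; apply: qexp_eq; rewrite /E1 /E4 /msum_exp; lia.
rewrite H2 [q ^+ d.+1 * _]mulrBr [q ^+ n * (_ * _)]mulrA
  ![q ^+ d.+1 * (_ * _)]mulrA H3 H4; ring_atoms.
Qed.

Lemma msum_coef_shift_n3 b c d n :
  msum_coef b c d n - msum_coef b c.+1 d n
  = q ^+ c.+1 * (msum_coef b c.+2 d n - msum_coef b.+1 c.+1 d n).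
Proof.
rewrite /msum_coef -!sumrB mulr_sumr; apply: eq_bigr => m _.
rewrite -!sumrB mulr_sumr.
apply: (sum_shift (F := fun j => \sum_(k < n.+1) msum_term b c d n m j k
                                 - \sum_(k < n.+1) msum_term b c.+1 d n m j k)
  (G := fun j => q ^+ c.+1 * (\sum_(k < n.+1) msum_term b c.+2 d n m j k
                        - \sum_(k < n.+1) msum_term b.+1 c.+1 d n m j k))) => [||j].
- by rewrite -!sumrB big1 // => k _; rewrite /msum_term !muln0 subrr.
- rewrite -!sumrB big1 // => k _; rewrite /msum_term (rfact_out (ltn_ord m)).
  by rewrite !(mulr0, mul0r) subr0.
rewrite -!sumrB mulr_sumr; apply: eq_bigr => k _.
rewrite /msum_term rfactSr -(rfactSl j 0) subn0.
have [jm|/rfact_out->] := leqP j m; last by rewrite !(mulr0, mul0r) ?(subrr, mulr0).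
set E1 := (_ + _ + c * j.+1 + _)%N; set E2 := (_ + _ + c.+1 * j.+1 + _)%N.
set E3 := (_ + _ + c.+2 * j + _)%N; set E4 := (_ + _ + c.+1 * j + _)%N.
have H2 : q ^+ E2 = q ^+ E1 * q ^+ j.+1 by rewrite -exprD; apply: qexp_eq;
  rewrite /E1 /E2; lia.
have H3 : q ^+ c.+1 * q ^+ E3 = q ^+ E1.
  by rewrite -exprD; apply: qexp_eq; rewrite /E1 /E3 /msum_exp; lia.
have H4 : q ^+ c.+1 * q ^+ E4 = q ^+ E1 * q ^+ (m - j).
  by rewrite -!exprD; apply: qexp_eq; rewrite /E1 /E4 /msum_exp; lia.
rewrite H2 [q ^+ c.+1 * _]mulrBr ![q ^+ c.+1 * (_ * _)]mulrA H3 H4; ring_atoms.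
Qed.

Lemma msum_coef_shift_n2 b c d n :
  q ^+ n * (msum_coef b c.+1 d n - msum_coef b.+1 c d n)
  = q ^+ b.+1 * (msum_coef b.+2 c.+1 d.+1 n - q ^+ n * msum_coef b.+1 c.+1 d.+1 n).
Proof.
rewrite /msum_coef -!sumrB mulr_sumr
  [q ^+ n * \sum_(m < _) \sum_(j < _) _]mulr_sumr -!sumrB mulr_sumr.
pose s b c d m := \sum_(j < n.+1) \sum_(k < n.+1) msum_term b c d n m j k.
apply: (sum_shift (F := fun m => q ^+ n * (s b c.+1 d m - s b.+1 c d m))
  (G := fun m => q ^+ b.+1 *
    (s b.+2 c.+1 d.+1 m - q ^+ n * s b.+1 c.+1 d.+1 m))) => [||m]; rewrite /s.
- rewrite -sumrB big1 ?mulr0 // => j _; rewrite -sumrB big1 // => k _.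
  case: (nat_of_ord j) => [|i]; first by rewrite /msum_term !muln0 subrr.
  by rewrite /msum_term (@rfact_out 0 i.+1) // !(mulr0, mul0r) subr0.
- rewrite -sumrB big1 ?mulr0 // => j _; rewrite -sumrB big1 // => k _.
  by rewrite /msum_term (rfact_out (ltnSn n)) !(mulr0, mul0r) subr0.
rewrite [q ^+ n * \sum_(j < _) _]mulr_sumr -!sumrB !mulr_sumr;
apply: eq_bigr => j _.
rewrite [q ^+ n * \sum_(k < _) _]mulr_sumr -!sumrB !mulr_sumr;
apply: eq_bigr => k _.
rewrite /msum_term rfactSr -(rfactSl m j).
have [mn|/rfact_out->] := leqP m n; last by rewrite !(mulr0, mul0r) ?(subrr, mulr0).
have [jm|/rfact_out->] := leqP j m.+1;
  last by rewrite !(mulr0, mul0r) ?(subrr, mulr0).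
have [->|m_neq_n] := eqVneq m n.
  rewrite subnn expr0 subrr [q ^+ n * (q ^+ _ * _)]mulrA -exprD.
  rewrite !(mulr0, mul0r).
  set E3 := (_ + b.+2 * n + _ + _)%N; set E4 := (n + _)%N.
  have -> : E4 = E3 by rewrite /E3 /E4; lia.
  by rewrite subrr mulr0.
set E1 := (_ + b * m.+1 + c.+1 * j + _)%N.
set E2 := (_ + b.+1 * m.+1 + c * j + _)%N.
set E3 := (_ + b.+2 * m + _ + _)%N; set E4 := (_ + b.+1 * m + _ + _)%N.
have EN : (n * (n - m) = n * (n - m.+1) + n)%N.
  by rewrite -mulnSr; congr (_ * _)%N; lia.
have H1 : q ^+ E2 = q ^+ E1 * q ^+ (m.+1 - j).
  by rewrite -exprD; apply: qexp_eq; rewrite /E1 /E2; lia.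
have H3 : q ^+ b.+1 * q ^+ E3 = q ^+ n * q ^+ E1.
  by rewrite -!exprD; apply: qexp_eq; rewrite /E1 /E3 /msum_exp; lia.
have H4 : q ^+ b.+1 * q ^+ n * q ^+ E4 = q ^+ n * q ^+ E1 * q ^+ (n - m).
  by rewrite -!exprD; apply: qexp_eq; rewrite /E1 /E4 /msum_exp; lia.
rewrite H1 [q ^+ b.+1 * _]mulrBr.
rewrite [q ^+ n * (q ^+ E4 * _)]mulrA ![q ^+ b.+1 * (_ * _)]mulrA H3 H4; ring_atoms.
Qed.

(** The factor 1 - q^(n1 - n2) lowers n1 in 1 / (q; q)_(n1 - n2), and the Pascal
    rule for [n1, n4] lowers n1 in the rest of the term. *)
Lemma msum_coef_pascal_n4 b c d n :
  msum_coef b.+1 c d n.+1 - q ^+ n.+1 * msum_coef b c d n.+1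
  = q ^+ (2 * n).+1 * msum_coef b c d n
    + q ^+ (3 * n + d).+2 * msum_coef b.+1 c d.+1 n.
Proof.
rewrite !(@msum_coef_widen _ _ _ n n.+2) // /msum_coef !mulr_sumr -sumrB
  -big_split /=.
apply: eq_bigr => m _; rewrite !mulr_sumr -sumrB -big_split /=.
apply: eq_bigr => j _; rewrite !mulr_sumr.
pose B k := if k is k'.+1 then q ^+ (3 * n + d).+2 *
  msum_term b.+1 c d.+1 n m j k' else 0.
rewrite -(sum_shift (F := B) (G := fun k =>
  q ^+ (3 * n + d).+2 * msum_term b.+1 c d.+1 n m j k)) //; last first.
  by rewrite /B /msum_term (rfact_out (ltnSn n)) !(mulr0, mul0r).
rewrite -sumrB -big_split /=; apply: eq_bigr => -[k /= _] _.
rewrite /B {B}; have [nm|mn] := ltnP n m.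
  have -> : msum_term b c d n m j k
    = 0 by rewrite /msum_term (rfact_out nm) !(mulr0, mul0r).
  have -> : (if k is k'.+1 then q ^+ (3 * n + d).+2 *
    msum_term b.+1 c d.+1 n m j k' else 0) = 0.
    by case: k => // k; rewrite /msum_term (rfact_out nm) !(mulr0, mul0r).
  have [mn|nm'] := leqP m n.+1;
    last by rewrite /msum_term (rfact_out nm') !(mulr0, mul0r, subr0, addr0).
  have -> : (m : nat) = n.+1 by lia.
  rewrite /msum_term [q ^+ n.+1 * _]mulrA -exprD mulr0 addr0; apply/eqP;
    rewrite subr_eq0; apply/eqP.
  by congr (_ * _); apply: qexp_eq; lia.
set A := _ - _; rewrite -[RHS]addr0.
have AE : A = q ^+ (2 * n).+1 * q ^+ (msum_exp n m j k + b * m + c * j + d * k)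
   * (qpoch q q n * (1 - q ^+ n.+1) *
     (rfact n m * rfact n.+1 k * rfact m j * rfact k 0 * rfact j 0)).
  rewrite /A /msum_term -(rfactSl n m) qfactS [q ^+ n.+1 * (q ^+ _ * _)]mulrA
    -!exprD.
  have -> : q ^+ (n.+1 + (msum_exp n.+1 m j k + b * m + c * j + d * k))
    = q ^+ (msum_exp n.+1 m j k + b.+1 * m + c * j + d * k) * q ^+ (n.+1 - m).
    by rewrite -exprD; apply: qexp_eq; lia.
  have -> : q ^+ (msum_exp n.+1 m j k + b.+1 * m + c * j + d * k) =
    q ^+ ((2 * n).+1 + (msum_exp n m j k + b * m + c * j + d * k)).
    apply: qexp_eq; rewrite /msum_exp.
    have -> : (n.+1 * (n.+1 - m) = n * (n - m) + n + n.+1 - m)%N by nia.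
    by lia.
  ring_atoms.
rewrite AE addr0 {A AE}; case: k => [|k].
  rewrite addr0 /msum_term -(rfactSl n 0) subn0; ring_atoms.
have [kn|nk] := leqP k n; last first.
  by rewrite /msum_term (rfact_out nk) (rfact_out (leqW nk)) rfactSS
    (rfact_out nk) !(mulr0, mul0r) addr0.
have H1 : q ^+ n.+1 = q ^+ (n - k) * q ^+ k.+1
  by rewrite -exprD; apply: qexp_eq; lia.
have H2 : q ^+ (3 * n + d).+2 *
  q ^+ (msum_exp n m j k + b.+1 * m + c * j + d.+1 * k)
   = q ^+ (2 * n).+1 * q ^+ (msum_exp n m j k.+1 + b * m + c * j + d * k.+1) *
     q ^+ (n - k).
  by rewrite -!exprD; apply: qexp_eq; rewrite /msum_exp; lia.
rewrite /msum_term [q ^+ (3 * n + d).+2 * _]mulrA H2 H1 rfactSS rfactSr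
  -(rfactSl k 0) subn0; ring_atoms.
Qed.

(** The next two lemmas put a sum at n into the box of the sums at n + 1, with
    m, or both m and j, raised by one, to be compared there term by term. *)
Lemma msum_coef_delay b c d n x :
  x * msum_coef b c d n = \sum_(m < n.+2) \sum_(j < n.+2) \sum_(k < n.+2)
    (if (m : nat) is m'.+1 then x * msum_term b c d n m' j k else 0).
Proof.
rewrite (@msum_coef_widen _ _ _ n n.+2) // mulr_sumr.
pose G m := x * \sum_(j < n.+2) \sum_(k < n.+2) msum_term b c d n m j k.
pose F m := if m is m'.+1 then G m' else 0.
rewrite -(sum_shift (F := F) (G := G)) /F /G //.
  apply: eq_bigr => -[[|m] /= _] _; first by rewrite big1 // => j _; rewrite big1.
  by rewrite mulr_sumr; apply: eq_bigr => j _; rewrite mulr_sumr.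
rewrite big1 ?mulr0 // => j _; rewrite big1 // => k _.
by rewrite /msum_term (rfact_out (ltnSn n)) !(mulr0, mul0r).
Qed.

Lemma msum_coef_delay2 b c d n x :
  x * msum_coef b c d n = \sum_(m < n.+2) \sum_(j < n.+2) \sum_(k < n.+2)
    (if (m : nat) is m'.+1 then
       if (j : nat) is j'.+1 then x * msum_term b c d n m' j' k else 0 else 0).
Proof.
rewrite msum_coef_delay; apply: eq_bigr => -[[|m] /= mn] _.
  by rewrite !big1 // => j _; rewrite big1.
pose G j := \sum_(k < n.+2) x * msum_term b c d n m j k.
pose F j := if j is j'.+1 then G j' else 0.
rewrite -(sum_shift (F := F) (G := G)) /F /G //.
  by apply: eq_bigr => -[[|j] /= _] _; first by rewrite big1.
rewrite big1 // => k _; have [m_n|nm] := ltnP m n.+1.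
  by rewrite /msum_term (@rfact_out m n.+1) // !(mulr0, mul0r).
by rewrite /msum_term (rfact_out nm) !(mulr0, mul0r).
Qed.

(** The factor 1 - q^(n1 - n4) lowers n1 in 1 / (q; q)_(n1 - n4), and the Pascal
    rules for [n1, n2] and then for [n2, n3] lower n1 in the rest of the term. *)
Lemma msum_coef_pascal_n2 b c d n :
  msum_coef b.+1 c d.+1 n.+1 - q ^+ n.+1 * msum_coef b.+1 c d n.+1
  = q ^+ (2 * n).+1 * msum_coef b c d.+1 n
    + q ^+ (2 * n + b).+2 * msum_coef b.+1 c d.+2 n
    + q ^+ (2 * n + b + c).+3 * msum_coef b.+2 c.+1 d.+2 n.
Proof.
rewrite (msum_coef_delay b.+1 c d.+2) (msum_coef_delay2 b.+2)
  (@msum_coef_widen b _ _ n n.+2) //.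
rewrite /msum_coef !mulr_sumr -sumrB -!big_split /=; apply: eq_bigr => -[m /= _] _.
rewrite ?mulr_sumr -?sumrB -?big_split /=. apply: eq_bigr => -[j /= _] _.
rewrite ?mulr_sumr -?sumrB -?big_split /=. apply: eq_bigr => -[k /= _] _.
have [nk|kn] := ltnP n k.
  have z b' c' d' m' j' : msum_term b' c' d' n m' j' k = 0.
    by rewrite /msum_term (rfact_out nk) !(mulr0, mul0r).
  rewrite z mulr0 add0r.
  have -> : (if m is m'.+1 then q ^+ (2 * n + b).+2 *
    msum_term b.+1 c d.+2 n m' j k else 0) = 0.
    by case: m => // m; rewrite z mulr0.
  rewrite add0r.
  have -> : (if m is m'.+1 then if j is j'.+1 then q ^+ (2 * n + b + c).+3 *
    msum_term b.+2 c.+1 d.+2 n m' j' k else 0 else 0) = 0.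
    by case: m => // m; case: j => // j; rewrite z mulr0.
  have [kn|nk'] := leqP k n.+1;
    last by rewrite /msum_term (rfact_out nk') !(mulr0, mul0r, subr0).
  have -> : k = n.+1 by lia.
  rewrite /msum_term [q ^+ n.+1 * (_ * _)]mulrA -exprD; apply/eqP;
    rewrite subr_eq0; apply/eqP.
  by congr (_ * _); apply: qexp_eq; lia.
have AE : msum_term b.+1 c d.+1 n.+1 m j k
  - q ^+ n.+1 * msum_term b.+1 c d n.+1 m j k
  = q ^+ (msum_exp n.+1 m j k + b.+1 * m + c * j + d.+1 * k)
   * (qpoch q q n * (1 - q ^+ n.+1) *
     (rfact n.+1 m * rfact n k * rfact m j * rfact k 0 * rfact j 0)).
  rewrite /msum_term -(rfactSl n k) qfactS [q ^+ n.+1 * (q ^+ _ * _)]mulrA -!exprD.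
  have -> : q ^+ (n.+1 + (msum_exp n.+1 m j k + b.+1 * m + c * j + d * k))
    = q ^+ (msum_exp n.+1 m j k + b.+1 * m + c * j + d.+1 * k) * q ^+ (n.+1 - k).
    by rewrite -exprD; apply: qexp_eq; lia.
  ring_atoms.
rewrite {}AE; have [nm|mn] := ltnP n.+1 m.
  case: m nm => // m nm; rewrite /msum_term !rfactSS !(@rfact_out n m)
    ?(@rfact_out n m.+1) ?(mulr0, mul0r, addr0) //; try lia.
  by case: j => [|j]; rewrite ?(mulr0, mul0r, addr0).
have H0 : (m <= n)%N -> q ^+ (msum_exp n.+1 m j k + b.+1 * m + c * j + d.+1 * k)
    = q ^+ (2 * n).+1 * q ^+ (msum_exp n m j k + b * m + c * j + d.+1 * k).
  move=> m_n; rewrite -exprD; apply: qexp_eq; rewrite /msum_exp.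
  have -> : (n.+1 * (n.+1 - m) = n * (n - m) + n + n.+1 - m)%N by nia.
  by lia.
case: m mn H0 => [|m] mn H0.
  rewrite H0 // !addr0 /msum_term -(rfactSl n 0) subn0; ring_atoms.
have EN : (n.+1 * (n.+1 - m.+1) = n * (n - m) + (n - m))%N
  by rewrite subSS mulSn addnC.
set E := (_ + b.+1 * m.+1 + _ + _)%N in H0 *.
have HA : q ^+ (2 * n).+1 * msum_term b c d.+1 n m.+1 j k = q ^+ E * (qpoch q q n *
    (rfact n m * (1 - q ^+ (n - m)) * rfact n k *
      rfact m.+1 j * rfact k 0 * rfact j 0)).
  rewrite /msum_term rfactSr; have [m_n|nm] := ltnP m n;
    first by rewrite H0 // mulrA.
  have -> : (n - m = 0)%N by lia.
  by rewrite expr0 subrr !(mulr0, mul0r).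
have Hn : q ^+ n.+1 = q ^+ (n - m) * q ^+ m.+1
  by rewrite -exprD; apply: qexp_eq; lia.
have HB : q ^+ (2 * n + b).+2 *
  q ^+ (msum_exp n m j k + b.+1 * m + c * j + d.+2 * k)
    = q ^+ E * q ^+ (n - m).
  by rewrite -!exprD; apply: qexp_eq; rewrite /E /msum_exp EN; lia.
have HC i : j = i.+1 -> (i <= m)%N ->
    q ^+ (2 * n + b + c).+3 *
      q ^+ (msum_exp n m i k + b.+2 * m + c.+1 * i + d.+2 * k)
    = q ^+ E * q ^+ (n - m) * q ^+ (m - i).
  by move=> ji im; rewrite -!exprD; apply: qexp_eq; rewrite /E /msum_exp EN ji; lia.
rewrite HA /msum_term [q ^+ (2 * n + b).+2 * _]mulrA HB Hn.
case: j {H0 HA} E HB HC => [|j] E HB HC.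
  rewrite rfactSS -(rfactSl m 0) subn0 addr0; ring_atoms.
have [jm|mj] := leqP j m; last first.
  by rewrite !rfactSS (rfact_out mj) (@rfact_out m j.+1) ?(mulr0, mul0r, addr0)
    // ltnW.
have Hm : q ^+ m.+1 = q ^+ (m - j) * q ^+ j.+1
  by rewrite -exprD; apply: qexp_eq; lia.
rewrite [q ^+ (2 * n + b + c).+3 * _]mulrA HC // Hm !rfactSS rfactSr
  -(rfactSl j 0) subn0; ring_atoms.
Qed.

End MultiSum.

(** * A system of q-difference equations for three series *)

(** The closed system: X, Y and W at index j stand for the values of three
    series at z q^j. *)
Record closed_system (T : comNzRingType) (q z : T) (X Y W : nat -> T) : Prop :=
  ClosedSystem {
    closed_X : X 0%N + W 2%N + z * q ^+ 2 * X 2%N =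
      z * q ^+ 2 * X 3%N + (1 + z * q) * Y 2%N + Y 1%N;
    closed_Y : Y 0%N = W 1%N + z * q * W 2%N + z * q * X 1%N
      + z * q ^+ 2 * Y 3%N + z * q ^+ 3 * X 4%N;
    closed_W : W 0%N - W 1%N + W 2%N = (1 + z * q) * Y 1%N + z * q * Y 2%N
      - z ^+ 2 * q ^+ 3 * X 2%N }.

Section MultiSumCertificate.
Variables (T : comNzRingType) (q z : T) (S : nat -> nat -> nat -> nat -> T).

(* The five contiguous relations, as differences of their two sides. *)
Let r1 a b c d := S a b.+1 c d - S a.+1 b c d
  - z * (q ^+ a.+1 * S a.+2 b c d + q ^+ (a + d).+2 * S a.+3 b.+1 c d.+1).
Let r2 a b c d := S a.+1 b c.+1 d - S a.+1 b.+1 c d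
  - q ^+ b.+1 * (S a b.+2 c.+1 d.+1 - S a.+1 b.+1 c.+1 d.+1).
Let r3 a b c d := S a b c d - S a b c.+1 d
  - q ^+ c.+1 * (S a b c.+2 d - S a b.+1 c.+1 d).
Let r4 a b c d := S a b c d - S a b c d.+1
  - q ^+ d.+1 * (S a b.+1 c d.+2 - S a.+1 b.+1 c d.+1).
Let r5 a b c d := S a b.+1 c d.+1 - S a.+1 b.+1 c d
  - z * (q ^+ a.+1 * S a.+2 b c d.+1 + q ^+ (a + b).+2 * S a.+2 b.+1 c d.+2
         + q ^+ (a + b + c).+3 * S a.+2 b.+2 c.+1 d.+2).

Hypotheses (r1_0 : forall a b c d, r1 a b c d = 0)
  (r2_0 : forall a b c d, r2 a b c d = 0)
  (r3_0 : forall a b c d, r3 a b c d = 0)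
  (r4_0 : forall a b c d, r4 a b c d = 0)
  (r5_0 : forall a b c d, r5 a b c d = 0).

Let X j := S j 1 1 1.
Let Y j := S j 0 1 0.
Let W j := S j 0 0 0.

(** The combinations of contiguous relations in the three proofs come from
    linear algebra over the monomials S a b c d with coefficients in q and z. *)
Let E1 k : X k + W k.+2 + z * q ^+ k.+2 * X k.+2 =
      z * q ^+ k.+2 * X k.+3 + (1 + z * q ^+ k.+1) * Y k.+2 + Y k.+1.
Proof.
apply: subr0_eq; transitivity
  (- q ^+ k.+2 * z * r4 k.+3 0 0 0 + r1 k 0 1 0 - r2 k 0 0 0
  - r4 k 1 1 0 - q * r1 k 1 1 1 - r2 k.+1 0 0 0 - r1 k.+1 0 0 0 + r5 k.+1 0 0 0
  + r4 k.+1 0 1 0 + r2 k 0 0 1).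
  by rewrite /X /Y /W /r1 /r2 /r3 /r4 /r5 !addn0 !addn1 !exprS; ring.
by rewrite !(r1_0, r2_0, r3_0, r4_0, r5_0); ring.
Qed.

Let E2 : Y 1 = W 2 + z * q ^+ 2 * W 3 + z * q ^+ 2 * X 2 + z * q ^+ 3 * Y 4
  + z * q ^+ 4 * X 5.
Proof.
apply: subr0_eq; transitivity (- q ^+ 3 * z * r2 3 0 0 1 - q ^+ 3 * z * r4 4 0 1 0
  + r2 0 0 0 0 + q * r1 0 1 1 1 + r1 1 0 0 0).
  by rewrite /X /Y /W /r1 /r2 /r3 /r4 /r5; ring.
by rewrite !(r1_0, r2_0, r3_0, r4_0, r5_0); ring.
Qed.

Let E3 : W 1 - W 2 + W 3 = (1 + z * q ^+ 2) * Y 2 + z * q ^+ 2 * Y 3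
      - z ^+ 2 * q ^+ 5 * X 3.
Proof.
have e1 := E1 1; have e2 := E2.
apply: subr0_eq.
transitivity ((X 1 + W 3 + z * q ^+ 3 * X 3
  - (z * q ^+ 3 * X 4 + (1 + z * q ^+ 2) * Y 3 + Y 2)) * (1 + q ^+ 2 * z)
  + (Y 1 - (W 2 + z * q ^+ 2 * W 3 + z * q ^+ 2 * X 2 + z * q ^+ 3 * Y 4
      + z * q ^+ 4 * X 5))
  - r5 1 0 1 0 - q ^+ 2 * z * r1 1 0 1 0 + q ^+ 2 * z * r4 1 1 1 0 - r1 2 0 1 0
  - q ^+ 2 * z * r4 2 0 1 0 - q ^+ 2 * z * r3 2 1 0 1 + q * r2 0 0 1 0
      + q ^+ 2 * z * r4 3 0 1 0
  + q ^+ 2 * r1 0 1 2 1 + r3 1 0 0 0 - q ^+ 2 * z * r2 1 0 0 1).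
  by rewrite {e1 e2} /X /Y /W /r1 /r2 /r3 /r4 /r5; ring.
rewrite !(r1_0, r2_0, r3_0, r4_0, r5_0) e1 e2; ring.
Qed.

(** The last two equations are those of the closed system after z -> z q. *)
Lemma multisum_certificate :
  [/\ X 0 + W 2 + z * q ^+ 2 * X 2 =
        z * q ^+ 2 * X 3 + (1 + z * q) * Y 2 + Y 1,
      Y 1 = W 2 + z * q ^+ 2 * W 3 + z * q ^+ 2 * X 2 + z * q ^+ 3 * Y 4
        + z * q ^+ 4 * X 5
    & W 1 - W 2 + W 3 = (1 + z * q ^+ 2) * Y 2 + z * q ^+ 2 * Y 3
        - z ^+ 2 * q ^+ 5 * X 3].
Proof. by split; [exact: (E1 0) | exact: E2 | exact: E3]. Qed.

End MultiSumCertificate.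

Section CorteelWelsh.
Variables (T : comNzRingType) (q z : T).
Variables g500 g410 g401 g320 g302 g311 g221 : nat -> T.

(** The functional equations for cylindric partitions of rank 3 and level 5: the
    indices are the seven profiles up to rotation, g c j stands for G_c(z q^j),
    and the equation for c runs over the nonempty sets J of nonzero parts of c,
    which act on c by moving one unit from each part in J to the next part. *)
Record corteel_welsh : Prop := CorteelWelsh {
  cw500 : forall j, g500 j = g410 j.+1;
  cw401 : forall j, g401 j = g311 j.+1 + g500 j.+1
    - (1 - z * q ^+ j.+1) * g410 j.+2;
  cw410 : forall j, g410 j = g320 j.+1 + g401 j.+1
    - (1 - z * q ^+ j.+1) * g311 j.+2;
  cw320 : forall j, g320 j = g302 j.+1 + g311 j.+1
    - (1 - z * q ^+ j.+1) * g221 j.+2;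
  cw302 : forall j, g302 j = g221 j.+1 + g401 j.+1
    - (1 - z * q ^+ j.+1) * g311 j.+2;
  cw311 : forall j, g311 j = g221 j.+1 + g302 j.+1 + g410 j.+1
    - (1 - z * q ^+ j.+1) * (g221 j.+2 + g320 j.+2 + g401 j.+2)
    + (1 - z * q ^+ j.+1) * (1 - z * q ^+ j.+2) * g311 j.+3;
  cw221 : forall j, g221 j = g311 j.+1 + g221 j.+1 + g320 j.+1
    - (1 - z * q ^+ j.+1) * (g221 j.+2 + g302 j.+2 + g311 j.+2)
    + (1 - z * q ^+ j.+1) * (1 - z * q ^+ j.+2) * g221 j.+3 }.

(** f401, f320 and f302 express the unknowns that are eliminated through X, Y and
    W; the equations for 320, 311 and 221 then become the closed system. *)
Lemma corteel_welsh_closed : corteel_welsh -> closed_system q z g410 g311 g221.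
Proof.
case=> e500 e401 e410 e320 e302 e311 e221.
have f401 j : g401 j = g311 j.+1 + z * q ^+ j.+1 * g410 j.+2.
  by rewrite e401 e500; ring.
have f320 j : g320 j.+1 = g410 j - z * q ^+ j.+2 * g410 j.+3
  - z * q ^+ j.+1 * g311 j.+2.
  by rewrite e410 f401; ring.
have f302 j : g302 j = g221 j.+1 + z * q ^+ j.+2 * g410 j.+3
  + z * q ^+ j.+1 * g311 j.+2.
  by rewrite e302 f401; ring.
have f311 j : g311 j = g221 j.+1 + z * q ^+ j.+1 * (g221 j.+2 + g410 j.+1)
    + z * q ^+ j.+2 * g311 j.+3 + z * q ^+ j.+3 * g410 j.+4.
  by rewrite e311 f302 f320 f401; ring.
have f410 : g410 0%N = g320 1%N + z * q ^+ 2 * g410 3%N + z * q * g311 2%N.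
  by rewrite f320; ring.
split.
- by rewrite f410 e320 f302 (f311 1%N); ring.
- by rewrite f311; ring.
- by rewrite e221 e320 !f302 (f311 1%N); ring.
Qed.

End CorteelWelsh.

(** * From the alternating sums to the Corteel-Welsh equations *)

Section CylindricSystem.
Variables (T : comNzRingType) (q z : T) (P : nat -> T).
Variable F : nat -> nat -> nat -> nat -> T.

Hypothesis P_rec : forall j, P j = (1 - z * q ^+ j) * P j.+1.
Hypothesis F_rec : forall s0 s1 s2 j,
  z * q ^+ j * F s0.+1 s1.+1 s2.+1 j = F s0.+1 s1.+1 s2.+1 j
    - (F s0 s1.+2 s2.+1 j.+1 + F s0.+1 s1 s2.+2 j.+1 + F s0.+2 s1.+1 s2 j.+1)
    + (F s0 s1.+1 s2.+2 j.+2 + F s0.+2 s1 s2.+1 j.+2 + F s0.+1 s1.+2 s2 j.+2)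
    - F s0.+1 s1.+1 s2.+1 j.+3.
Hypothesis F_wall : forall s0 s2 j, F s0.+1 0 s2 j = F s0 1 s2 j.+1.
Hypothesis F_rot : forall s0 s1 s2 j, F s1 s2 s0 j = F s0 s1 s2 j.

Let G s0 s1 s2 j := P j * F s0 s1 s2 j.

(** In the recurrence F_rec all eight subsets occur. Those that contain a zero
    part of the profile lead to a wall, where F_wall makes them cancel; the factor
    P, which stands for (z q^j; q)_oo, absorbs the different shifts of z. *)
Lemma cylindric_corteel_welsh :
  corteel_welsh q z (G 6 1 1) (G 5 2 1) (G 5 1 2) (G 4 3 1) (G 4 1 3) (G 4 2 2)
    (G 3 3 2).
Proof.
have rec s0 s1 s2 j : (1 - z * q ^+ j) * F s0.+1 s1.+1 s2.+1 j =
    F s0 s1.+2 s2.+1 j.+1 + F s0.+1 s1 s2.+2 j.+1 + F s0.+2 s1.+1 s2 j.+1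
    - (F s0 s1.+1 s2.+2 j.+2 + F s0.+2 s1 s2.+1 j.+2 + F s0.+1 s1.+2 s2 j.+2)
    + F s0.+1 s1.+1 s2.+1 j.+3.
  by rewrite mulrBl mul1r F_rec; ring.
have wall2 s0 s1 j : F s0 s1.+1 0 j = F s0 s1 1 j.+1.
  by rewrite -F_rot F_wall F_rot.
have step s0 s1 s2 j : G s0.+1 s1.+1 s2.+1 j
  = P j.+1 * ((1 - z * q ^+ j) * F s0.+1 s1.+1 s2.+1 j).
  by rewrite /G P_rec; ring.
split=> j; rewrite step rec /G ?F_wall ?wall2 ?F_wall.
all: rewrite ?(P_rec j.+1) ?(P_rec j.+2) ?(F_rot 3 4 1) ?(F_rot 4 3 1)
  ?(F_rot 3 2 3) ?(F_rot 3 3 2) ?(F_rot 2 2 4) ?(F_rot 4 2 2); ring.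
Qed.

End CylindricSystem.

(** * Power series in z, and uniqueness *)

Section Dilation.
Local Notation q := (fpsX int).
Local Notation z := (fpsX {fps int}).
Local Notation Q := (fpsC q).

(** The substitution z -> z q^j. *)
Definition dilate (j : nat) (f : {fps {fps int}}) : {fps {fps int}} :=
  FPS (fun n => q ^+ (j * n) * coef_fps f n).

Lemma coef_QXM k (f : {fps {fps int}}) n :
  coef_fps (Q ^+ k * f) n = q ^+ k * coef_fps f n.
Proof.
elim: k f => [|k IHk] f; first by rewrite !expr0 !mul1r.
by rewrite exprSr -mulrA IHk coef_fpsCM mulrA exprSr.
Qed.

Lemma dilateM j f g : dilate j (f * g) = dilate j f * dilate j g.
Proof.
apply: fpsP => n; rewrite [LHS]/= !coef_fpsM mulr_sumr; apply: eq_bigr => i _ /=.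
have -> : (j * n = j * i + j * (n - i))%N by have := ltn_ord i; nia.
by rewrite exprD; move: (coef_fps f _) (coef_fps g _) => x y; gen_exp; ring.
Qed.

Lemma dilateD j f g : dilate j (f + g) = dilate j f + dilate j g.
Proof. by apply: fpsP => n /=; rewrite mulrDr. Qed.

Lemma dilateN j f : dilate j (- f) = - dilate j f.
Proof. by apply: fpsP => n /=; rewrite mulrN. Qed.

Lemma dilate_dilate i j f : dilate i (dilate j f) = dilate (i + j) f.
Proof. by apply: fpsP => n /=; rewrite mulrA -exprD mulnDl. Qed.

Lemma dilate0 f : dilate 0 f = f.
Proof. by apply: fpsP => n /=; rewrite mul1r. Qed.

Lemma dilate1 j : dilate j 1 = 1.
Proof.
apply: fpsP => n; rewrite [LHS]/= -[(if _ then _ else _)]/(coef_fps 1 n) !coef_fps1.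
by case: n => [|n]; rewrite ?muln0 ?mul1r ?mulr0.
Qed.

Lemma dilate_z j : dilate j z = z * Q ^+ j.
Proof.
apply: fpsP => n; rewrite mulrC coef_QXM.
have [->|n1] := eqVneq n 1%N; first by rewrite [LHS]/= muln1.
have zn : coef_fps z n = 0 by rewrite /= (negbTE n1).
by rewrite -[LHS]/(_ * coef_fps z n) zn !mulr0.
Qed.

Lemma dilate_QX j k : dilate j (Q ^+ k) = Q ^+ k.
Proof.
apply: fpsP => n; rewrite -[Q ^+ k]mulr1 -[LHS]/(q ^+ (j * n) * coef_fps _ n)
  !coef_QXM coef_fps1.
by case: n => [|n]; rewrite ?muln0 ?mul1r ?mulr0.
Qed.

Lemma qX_mulI k (x y : {fps int}) : q ^+ k * x = q ^+ k * y -> x = y.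
Proof.
move=> xy; apply: fpsP => d.
have := congr1 (fun f : {fps int} => coef_fps f (k + d)) xy.
by rewrite !coef_fpsXnM ltnNge leq_addr addKn.
Qed.

Lemma dilate_inj j : injective (dilate j).
Proof.
move=> f g fg; apply: fpsP => n.
have : coef_fps (dilate j f) n = coef_fps (dilate j g) n by rewrite fg.
exact: qX_mulI.
Qed.

(** A solution of the closed system is determined by its constant terms:
    at order n the system reads Y = q^n W, X + q^(2n) W = (q^(2n) + q^n) Y and
    (1 - q^n + q^(2n)) W = q^n Y modulo lower orders, whence (1 - q^n) W = 0. *)
Lemma closed_system_zero (X Y W : {fps {fps int}}) :
    closed_system Q z (dilate^~ X) (dilate^~ Y) (dilate^~ W) ->
    coef_fps X 0 = 0 -> coef_fps Y 0 = 0 -> coef_fps W 0 = 0 ->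
  [/\ X = 0, Y = 0 & W = 0].
Proof.
case=> eX eY eW X0 Y0 W0.
suff h n : [/\ coef_fps X n = 0, coef_fps Y n = 0 & coef_fps W n = 0].
  by split; apply: fpsP => n; have [] := h n.
elim/ltn_ind: n => -[|n] IH; first by split.
have low (f : {fps {fps int}}) : (forall m, (m <= n)%N -> coef_fps f m = 0) ->
    forall j g, coef_fps (z * g * dilate j f) n.+1 = 0.
  move=> f0 j g; rewrite -mulrA coef_fpsXM coef_fpsM big1 // => i _ /=.
  by rewrite f0 ?mulr0 // leq_subr.
have lowX := low X (fun m mn => let: And3 h _ _ := IH m mn in h).
have lowY := low Y (fun m mn => let: And3 _ h _ := IH m mn in h).
have lowW := low W (fun m mn => let: And3 _ _ h := IH m mn in h).
have cX := congr1 (fun f : {fps {fps int}} => coef_fps f n.+1) eX.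
have cY := congr1 (fun f : {fps {fps int}} => coef_fps f n.+1) eY.
have cW := congr1 (fun f : {fps {fps int}} => coef_fps f n.+1) eW.
rewrite !mulrDl !mul1r expr2 -?[z * z * _]mulrA {eX eY eW IH low} in cX cY cW.
rewrite ?coef_fpsD ?lowX ?lowY ?lowW ?addr0 ?add0r in cX cY.
rewrite !(coef_fpsD, coef_fpsN) !lowX !lowY subr0 !addr0 in cW.
have dE j f : coef_fps (dilate j f) n.+1 = q ^+ n.+1 ^+ j * coef_fps f n.+1.
  by rewrite /= mulnC exprM.
rewrite !dE expr0 !mul1r in cX cY cW.
move: cX cY cW.
move: (coef_fps X _) (coef_fps Y _) (coef_fps W _) => x y w.
move=> cX cY cW.
have uq : 1 - q ^+ n.+1 \is a GRing.unit.
  by rewrite fps_unitE coef_fpsB coef_fps1 coef_fpsX_small ?subr0 ?unitr1.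
move: (q ^+ n.+1) uq cX cY cW => u uu cX cY cW.
have w0 : w = 0.
  apply: (mulrI uu); apply: subr0_eq.
  transitivity (w - u ^+ 1 * w + u ^+ 2 * w - u ^+ 1 * y); first by rewrite cY;
    ring.
  by rewrite cW ?(addr0, add0r, subr0) subrr.
have y0 : y = 0 by rewrite cY w0 mulr0.
by move: cX; rewrite w0 y0 !mulr0 !addr0.
Qed.

End Dilation.

(** * The cylindric series are the multiple sums *)

Section GeneratingSeries.
Local Notation q := (fpsX int).
Local Notation z := (fpsX {fps int}).
Local Notation Q := (fpsC q).

(** Euler's series for 1 / (z; q)_oo. *)
Definition euler_series : {fps {fps int}} := FPS (fun n => (qpoch q q n)^-1).

Lemma euler_series_unit : euler_series \is a GRing.unit.
Proof. by rewrite fps_unitE /= qpoch0 invr1 unitr1. Qed.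

Lemma euler_series_dilate : dilate 1 euler_series = (1 - z) * euler_series.
Proof.
apply: fpsP => -[|n]; rewrite mulrBl mul1r coef_fpsB coef_fpsXM.
  by rewrite subr0 /= mul1r.
have u : 1 - q ^+ n.+1 \is a GRing.unit.
  by rewrite fps_unitE coef_fpsB coef_fps1 coef_fpsX_small ?subr0 ?unitr1.
rewrite /= qfactS invrM ?qfact_unit // mul1n.
have : (qpoch q q n)^-1 = (1 - q ^+ n.+1) * ((1 - q ^+ n.+1)^-1 * (qpoch q q n)^-1).
  by rewrite mulVKr.
move=> h; rewrite [X in _ = _ - X]h; set y := (1 - q ^+ n.+1)^-1 * _.
by clearbody y; gen_exp; ring.
Qed.

Lemma euler_series_inv j : dilate j euler_series^-1
  = (1 - z * Q ^+ j) * dilate j.+1 euler_series^-1.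
Proof.
have uE := euler_series_unit.
have base : euler_series^-1 = (1 - z) * dilate 1 euler_series^-1.
  apply: (mulrI uE); rewrite mulrV // mulrA [euler_series * _]mulrC.
  by rewrite -euler_series_dilate -dilateM mulrV // dilate1.
rewrite {1}base dilateM dilate_dilate addn1; congr (_ * _).
by rewrite dilateD dilateN dilate1 dilate_z.
Qed.

Definition cyl_series s0 s1 s2 : {fps {fps int}} :=
  FPS (fun n => cyl_sum s0 s1 s2 n).

(** The inverse of Euler's series is (z; q)_oo. *)
Definition cyl_gen s0 s1 s2 := euler_series^-1 * cyl_series s0 s1 s2.

Lemma cyl_gen_corteel_welsh :
  corteel_welsh Q z (dilate^~ (cyl_gen 6 1 1)) (dilate^~ (cyl_gen 5 2 1))
    (dilate^~ (cyl_gen 5 1 2)) (dilate^~ (cyl_gen 4 3 1))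
    (dilate^~ (cyl_gen 4 1 3)) (dilate^~ (cyl_gen 4 2 2))
    (dilate^~ (cyl_gen 3 3 2)).
Proof.
pose F s0 s1 s2 j := dilate j (cyl_series s0 s1 s2).
have := @cylindric_corteel_welsh _ Q z (fun j => dilate j euler_series^-1) F.
case; first exact: euler_series_inv.
- move=> s0 s1 s2 j.
  have base : z * cyl_series s0.+1 s1.+1 s2.+1 = cyl_series s0.+1 s1.+1 s2.+1
      - (F s0 s1.+2 s2.+1 1%N + F s0.+1 s1 s2.+2 1%N + F s0.+2 s1.+1 s2 1%N)
      + (F s0 s1.+1 s2.+2 2%N + F s0.+2 s1 s2.+1 2%N + F s0.+1 s1.+2 s2 2%N)
      - F s0.+1 s1.+1 s2.+1 3%N.
    apply: fpsP => n; transitivity (cyl_sum s0.+1 s1.+1 s2.+1 (n%:Z - 1)).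
      rewrite coef_fpsXM; case: n => [|n]; first by rewrite sub0r cyl_sumN1.
      by congr cyl_sum; lia.
    by rewrite cyl_sumB1 !(coef_fpsD, coef_fpsN) /F /= mul1n !mulrDr.
  have := congr1 (dilate j) base.
  rewrite !(dilateM, dilateD, dilateN, dilate_z) /F !dilate_dilate.
  by rewrite !addnS !addn0.
- move=> s0 s2 j; rewrite /F -[j.+1]addn1 -dilate_dilate; congr dilate.
  by apply: fpsP => n /=; rewrite mul1n cyl_sum_wall.
- move=> s0 s1 s2 j; congr dilate; apply: fpsP => n /=.
  have [/eqP|s_gt0] := posnP (s0 + s1 + s2)%N; last exact: cyl_sum_rot.
  by rewrite !addn_eq0 => /andP[/andP[/eqP-> /eqP->] /eqP->].
by move=> c1 c2 c3 c4 c5 c6 c7; split=> j; rewrite /cyl_gen !dilateM;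
  [apply: c1|apply: c2|apply: c3|apply: c4|apply: c5|apply: c6|apply: c7].
Qed.

Lemma dilate_Q j : dilate j Q = Q.
Proof. exact: dilate_QX j 1. Qed.

Lemma dilate_msum i a b c d : dilate i (msum a b c d) = msum (i + a) b c d.
Proof. by apply: fpsP => n /=; rewrite mulrA -exprD mulnDl. Qed.

Lemma msum_closed : closed_system Q z (fun j => msum j 1 1 1) (fun j =>
  msum j 0 1 0)
  (fun j => msum j 0 0 0).
Proof.
have cE a b c d n : coef_fps (msum a b c d) n = (q ^+ n) ^+ a * msum_coef b c d n.
  by rewrite /= mulnC exprM.
have c0 b c d : msum_coef b c d 0 = 1.
  by rewrite /msum_coef !big_ord1 /msum_term /rfact /= !muln0 qpoch0 invr1 !mulr1.
have e2 n : q ^+ (2 * n).+1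
  = q * (q ^+ n * q ^+ n) by rewrite exprS mul2n -addnn exprD.
have e3 n d : q ^+ (3 * n + d).+2 = q * (q * (q ^+ n * (q ^+ n * q ^+ n) * q ^+ d)).
  by rewrite !exprS -!exprD; congr (_ * (_ * q ^+ _)); lia.
have [] := @multisum_certificate _ Q z msum.
- move=> a b c d; apply: fpsP => -[|n]; rewrite !coef_fpsB coef_fpsXM coef_fps0.
    by rewrite !cE !c0 !expr0 !expr1n subrr subr0.
  rewrite coef_fpsD !coef_QXM !cE.
  transitivity (q ^+ n.+1 ^+ a *
    (msum_coef b.+1 c d n.+1 - q ^+ n.+1 * msum_coef b c d n.+1
    - (q ^+ (2 * n).+1 * msum_coef b c d n
        + q ^+ (3 * n + d).+2 * msum_coef b.+1 c d.+1 n))).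
    rewrite e2 e3 ![q ^+ n.+1]exprS ![q ^+ _.+1]exprS ![q ^+ n ^+ _.+1]exprS.
    rewrite ![(q * q ^+ n) ^+ _.+1]exprS !exprMn exprD.
    by move: (q ^+ n) (msum_coef _ _ _ _) (msum_coef _ _ _ _)
      (msum_coef _ _ _ _) (msum_coef _ _ _ _) => *; ring.
  by rewrite msum_coef_pascal_n4 subrr mulr0.
- move=> a b c d; apply: fpsP => n;
    rewrite !coef_fpsB coef_fps0 coef_QXM coef_fpsB !cE.
  transitivity (q ^+ n ^+ a *
    (q ^+ n * (msum_coef b c.+1 d n - msum_coef b.+1 c d n)
    - q ^+ b.+1 * (msum_coef b.+2 c.+1 d.+1 n
        - q ^+ n * msum_coef b.+1 c.+1 d.+1 n))).
    rewrite [q ^+ n ^+ a.+1]exprS.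
    by move: (q ^+ n) (msum_coef _ _ _ _) (msum_coef _ _ _ _)
      (msum_coef _ _ _ _) (msum_coef _ _ _ _) => *; ring.
  by rewrite msum_coef_shift_n2 subrr mulr0.
- move=> a b c d; apply: fpsP => n;
    rewrite !coef_fpsB coef_fps0 coef_QXM coef_fpsB !cE.
  by rewrite -!mulrBr mulrCA -mulrBr msum_coef_shift_n3 subrr mulr0.
- move=> a b c d; apply: fpsP => n;
    rewrite !coef_fpsB coef_fps0 coef_QXM coef_fpsB !cE.
  transitivity (q ^+ n ^+ a * (msum_coef b c d n - msum_coef b c d.+1 n
    - q ^+ d.+1 * (msum_coef b.+1 c d.+2 n - q ^+ n * msum_coef b.+1 c d.+1 n))).
    rewrite [q ^+ n ^+ a.+1]exprS.
    by move: (q ^+ n) (msum_coef _ _ _ _) (msum_coef _ _ _ _)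
      (msum_coef _ _ _ _) (msum_coef _ _ _ _) => *; ring.
  by rewrite msum_coef_shift_n4 subrr mulr0.
- move=> a b c d; apply: fpsP => -[|n]; rewrite !coef_fpsB coef_fpsXM coef_fps0.
    by rewrite !cE !c0 !expr0 !expr1n subrr subr0.
  rewrite !coef_fpsD !coef_QXM !cE.
  transitivity (q ^+ n.+1 ^+ a *
    (msum_coef b.+1 c d.+1 n.+1 - q ^+ n.+1 * msum_coef b.+1 c d n.+1
    - (q ^+ (2 * n).+1 * msum_coef b c d.+1 n
        + q ^+ (2 * n + b).+2 * msum_coef b.+1 c d.+2 n
       + q ^+ (2 * n + b + c).+3 * msum_coef b.+2 c.+1 d.+2 n))).
    rewrite -![(2 * n + _ + _)%N]addnA !mul2n -!addnn.
    rewrite ![q ^+ n.+1]exprS ![q ^+ _.+1]exprS ![q ^+ n ^+ _.+1]exprS.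
    rewrite ![(q * q ^+ n) ^+ _.+1]exprS !exprMn !exprD.
    by move: (q ^+ n) (msum_coef _ _ _ _) (msum_coef _ _ _ _)
      (msum_coef _ _ _ _) (msum_coef _ _ _ _) (msum_coef _ _ _ _) => *; ring.
  by rewrite msum_coef_pascal_n2 subrr mulr0.
move=> eX eY eW.
have dil a b c d : msum a.+1 b c d = dilate 1 (msum a b c d) by rewrite dilate_msum.
split; first exact: eX.
  apply: (@dilate_inj 1); rewrite !(dilateD, dilateM, dilate_z, dilate_QX,
    dilate_Q).
  by rewrite -!dil eY; ring.
apply: (@dilate_inj 1).
rewrite !(dilateD, dilateM, dilateN, dilate_z, dilate_QX, dilate_Q, dilate1).
by rewrite -!dil eW; ring.
Qed.

(** The closed system is linear. *)
Lemma closed_system_unique (X Y W X' Y' W' : {fps {fps int}}) :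
    closed_system Q z (dilate^~ X) (dilate^~ Y) (dilate^~ W) ->
    closed_system Q z (dilate^~ X') (dilate^~ Y') (dilate^~ W') ->
    coef_fps X 0 = coef_fps X' 0 -> coef_fps Y 0 = coef_fps Y' 0 ->
    coef_fps W 0 = coef_fps W' 0 ->
  [/\ X = X', Y = Y' & W = W'].
Proof.
move=> [eX eY eW] [eX' eY' eW'] hX hY hW.
have [|||| dX dY dW] := @closed_system_zero (X - X') (Y - Y') (W - W').
- have dB j (f g : {fps {fps int}}) : dilate j (f - g) = dilate j f - dilate j g.
    by rewrite dilateD dilateN.
  split; rewrite !dB; apply: subr0_eq.
  + move/eqP: eX; rewrite -subr_eq0 => /eqP eX; move/eqP: eX';
      rewrite -subr_eq0 => /eqP eX'.
    by rewrite -[RHS](subrr 0) -[X in _ = X - _]eX -[X in _ = _ - X]eX'; ring.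
  + move/eqP: eY; rewrite -subr_eq0 => /eqP eY; move/eqP: eY';
      rewrite -subr_eq0 => /eqP eY'.
    by rewrite -[RHS](subrr 0) -[X in _ = X - _]eY -[X in _ = _ - X]eY'; ring.
  + move/eqP: eW; rewrite -subr_eq0 => /eqP eW; move/eqP: eW';
      rewrite -subr_eq0 => /eqP eW'.
    by rewrite -[RHS](subrr 0) -[X in _ = X - _]eW -[X in _ = _ - X]eW'; ring.
- by rewrite coef_fpsB hX subrr.
- by rewrite coef_fpsB hY subrr.
- by rewrite coef_fpsB hW subrr.
by split; apply: subr0_eq.
Qed.

Theorem cyl_gen_msum :
  [/\ cyl_gen 6 1 1 = msum 1 1 1 1, cyl_gen 5 2 1 = msum 0 1 1 1,
      cyl_gen 4 2 2 = msum 0 0 1 0 & cyl_gen 3 3 2 = msum 0 0 0 0].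
Proof.
have g0 s0 s1 s2 : (0 < s0 + s1 + s2)%N -> coef_fps (cyl_gen s0 s1 s2) 0 = 1.
  move=> s_gt0; have := congr1 (fun f : {fps {fps int}} => coef_fps f 0)
    (mulVr euler_series_unit).
  rewrite !coef_fps0M coef_fps1 /= qpoch0 invr1 mulr1 => ->.
  by rewrite mul1r cyl_sum0.
have m0 a b c d : coef_fps (msum a b c d) 0 = 1.
  by rewrite /= /msum_coef !big_ord1 /msum_term /rfact /= !muln0 qpoch0 invr1
    !mulr1.
have cw := cyl_gen_corteel_welsh.
have md b c d : (fun j => msum j b c d) = dilate^~ (msum 0 b c d).
  by apply/funext => j; rewrite dilate_msum addn0.
have := msum_closed; rewrite !md => ms.
have [||| eX eY eW] := closed_system_unique (corteel_welsh_closed cw) ms;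
  rewrite ?g0 ?m0 //.
split=> //; have [/(_ 0%N)] := cw; rewrite dilate0 => -> _ _ _ _ _ _.
by rewrite eX dilate_msum.
Qed.

End GeneratingSeries.

(** * Evaluation at z = 1 *)

Section Values.
Local Notation q := (fpsX int).

Definition quad_term a b c d (n : nat * nat * nat * nat) : {fps int} :=
  let: (n1, n2, n3, n4) := n in
  q ^+ (Qform n1 n2 n3 n4 + a * n1 + b * n2 + c * n3 + d * n4) / qpoch q q n1
    * qbinom q n1 n2 * qbinom q n1 n4 * qbinom q n2 n3.

Lemma Qform_ge (n1 n2 n3 n4 : nat) :
  [/\ n1 <= Qform n1 n2 n3 n4, n2 <= Qform n1 n2 n3 n4,
      n3 <= Qform n1 n2 n3 n4 & n4 <= Qform n1 n2 n3 n4]%N.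
Proof.
have sq k : (k <= k ^ 2)%N by case: k => // k; rewrite expnS expn1 leq_pmulr.
have le (k l : nat) : (k <= l)%N -> (k * l + l <= k ^ 2 + l ^ 2)%N.
  move=> kl; have [m ->] : exists m, l = (k + m)%N by exists (l - k)%N; lia.
  by have := sq k; have := sq m; rewrite -!mulnn; nia.
have {}le : (n1 * n2 + maxn n1 n2 <= n1 ^ 2 + n2 ^ 2)%N.
  by case: (leqP n1 n2) => h;
    [|rewrite mulnC addnC [X in (_ <= X)%N]addnC addnC]; apply: le; rewrite // ltnW.
have [h3 h4] := (sq n3, sq n4).
have := leq_maxl n1 n2; have := leq_maxr n1 n2.
by rewrite /Qform; move: (maxn _ _) le => M le; split; lia.
Qed.

Lemma coef_quad_term_lt a b c d n e :
  (e < let: (n1, n2, n3, n4) := n in Qform n1 n2 n3 n4)%N ->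
  coef_fps (quad_term a b c d n) e = 0.
Proof.
case: n => [[[n1 n2] n3] n4] eQ; rewrite /quad_term.
rewrite [_ / _]mulrC -!mulrA mulrCA coef_fpsXnM ifT //.
by lia.
Qed.

Lemma quad_term_summable a b c d : fps_summable (quad_term a b c d).
Proof.
move=> e; pose r := iota 0 e.+1.
exists [seq (x, n4) | x <-
  [seq (x, n3) | x <- [seq (n1, n2) | n1 <- r, n2 <- r], n3 <- r], n4 <- r].
move=> [[[n1 n2] n3] n4] nr; apply: coef_quad_term_lt.
rewrite ltnNge; apply: contra nr => Qe; have [h1 h2 h3 h4] := Qform_ge n1 n2 n3 n4.
have inr k : (k <= Qform n1 n2 n3 n4)%N -> k \in r by move=> kQ;
  rewrite mem_iota; lia.
by do 3! [apply: allpairs_f; last exact: inr]; apply: inr.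
Qed.

Lemma quad_term_msum a b c d n1 n2 n3 n4 :
  quad_term a b c d (n1, n2, n3, n4) = q ^+ (a * n1) * msum_term b c d n1 n2 n3 n4.
Proof.
have bE k l : qbinom q k l = qpoch q q k * rfact l 0 * rfact k l.
  rewrite /qbinom /rfact subn0 leq0n; case: leqP => _; last by rewrite mulr0.
  by rewrite invrM ?qfact_unit // -[RHS]mulrA; congr (_ * _); apply: mulrC.
have ri k : rfact k 0 * qpoch q q k
  = 1 by rewrite /rfact /= subn0 mulVr ?qfact_unit.
rewrite /quad_term !bE; have [n12|/rfact_out n12] := leqP n2 n1; last first.
  by rewrite /msum_term n12 !(mulr0, mul0r).
have -> : (qpoch q q n1)^-1 = rfact n1 0 by rewrite /rfact /= subn0.
have -> : (Qform n1 n2 n3 n4 + a * n1 + b * n2 + c * n3 + d * n4 =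
  a * n1 + (msum_exp n1 n2 n3 n4 + b * n2 + c * n3 + d * n4))%N.
  by rewrite /msum_exp /Qform mulnBr; nia.
rewrite exprD /msum_term; set E := q ^+ (msum_exp _ _ _ _ + _ + _ + _).
transitivity (q ^+ (a * n1) *
  (E * (qpoch q q n1 * (rfact n1 n2 * rfact n1 n4 * rfact n2 n3 *
    rfact n4 0 * rfact n3 0)))
  * (rfact n1 0 * qpoch q q n1) * (rfact n2 0 * qpoch q q n2)).
  by rewrite /E; ring_atoms.
by rewrite !ri !mulr1.
Qed.

Lemma has_sum_nat (F : nat -> {fps int}) N : (forall k, (N <= k)%N -> F k = 0) ->
  fps_has_sum F (\sum_(k < N) F k).
Proof.
move=> F0; have := has_sum_finite (F := F) (iota_uniq 0 N).
rewrite -[\sum_(k < N) _](big_mkord xpredT F) /index_iota subn0; apply=> k.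
by rewrite mem_iota -leqNgt; apply: F0.
Qed.

(** For fixed n1 the sum is finite, and is the coefficient of z^n1. *)
Lemma quad_sum_msum a b c d S : fps_has_sum (quad_term a b c d) S ->
  fps_has_sum (coef_fps (msum a b c d)) S.
Proof.
move=> h4.
pose s3 (x : nat * nat * nat) : {fps int} := let: (n1, n2, n3) := x in
  \sum_(k < n1.+1) q ^+ (a * n1) * msum_term b c d n1 n2 n3 k.
pose s2 (x : nat * nat) : {fps int} :=
  let: (n1, n2) := x in \sum_(j < n1.+1) s3 (x, j : nat).
have h3 : fps_has_sum s3 S.
  apply: has_sum_pair h4 _ => -[[n1 n2] n3].
  have h k : q ^+ (a * n1) * msum_term b c d n1 n2 n3 k
    = quad_term a b c d (n1, n2, n3, k).
    by rewrite quad_term_msum.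
  apply: (eq_has_sum h).
  apply: (has_sum_nat (F := fun k =>
    q ^+ (a * n1) * msum_term b c d n1 n2 n3 k)) => k nk.
  by rewrite /= /msum_term (rfact_out nk) !(mulr0, mul0r).
have h2 : fps_has_sum s2 S.
  apply: has_sum_pair h3 _ => -[n1 n2].
  apply: (has_sum_nat (F := fun j => s3 (n1, n2, j))) => j nj.
  rewrite /s3 big1 // => k _; have [n12|/rfact_out n12] := leqP n2 n1; last first.
    by rewrite /msum_term n12 !(mulr0, mul0r).
  by rewrite /msum_term (@rfact_out n2 j) ?(mulr0, mul0r) //; lia.
apply: has_sum_pair h2 _ => n1.
have -> : coef_fps (msum a b c d) n1 = \sum_(m < n1.+1) s2 (n1, m : nat).
  rewrite /= /msum_coef /s2 /s3 mulr_sumr; apply: eq_bigr => m _.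
  by rewrite mulr_sumr; apply: eq_bigr => j _; rewrite mulr_sumr.
apply: (has_sum_nat (F := fun m => s2 (n1, m))) => m nm.
by rewrite /s2 /s3 big1 // => j _; rewrite big1 // => k _;
  rewrite /msum_term (rfact_out nm) !(mulr0, mul0r).
Qed.

(** Both sides come from the limit of cyl_sum for N -> oo: termwise it is L
    divided by (q; q)_oo^3, and as a coefficient of the product of Euler's series
    by the multiple sum it is the value of the latter divided by (q; q)_oo. *)
Lemma quad_sum_value K s0 s1 s2 a b c d L : (0 < K)%N -> (s0 + s1 + s2 = K)%N ->
  cyl_gen s0 s1 s2 = msum a b c d ->
  fps_has_sum (fun v : bool * int * int =>
    (-1) ^+ v.1.1 * q ^+ weyl_exp K s0 s1 s2 v) L ->
  fps_has_sum (quad_term a b c d) ((qpoch_oo q q)^-1 ^+ 2 * L).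
Proof.
move=> K_gt0 sK gm ML; have [S quadS] :=
  summable_has_sum (quad_term_summable a b c d).
have mS := quad_sum_msum quadS.
have q0 : coef_fps q 0 = 0 by [].
have uP : qpoch_oo q q \is a GRing.unit by apply: qpoch_oo_unit.
have lim1 := cyl_sum_lim K_gt0 sK ML.
have lim2 : fps_cvg (fun N : nat => cyl_sum s0 s1 s2 N) ((qpoch_oo q q)^-1 * S).
  apply: (has_sum_lim (F := fun N n : nat =>
    rpoch q (N%:Z + - n%:Z) * coef_fps (msum a b c d) n) _ _ _ (has_sumZ _ mS)).
  - move=> e; have [s us s0'] := summable_le e (has_sum_summable mS).
    exists s => N n /s0' ns; rewrite coef_fpsM big1 // => i _.
    by rewrite ns ?mulr0 // leq_subr.
  - by move=> n; apply: fps_cvgM; [exact: rpoch_cvg|exact: fps_cvg_cst].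
  move=> N; have -> : cyl_sum s0 s1 s2 N
    = \sum_(n < N.+1) rpoch q (N%:Z + - n%:Z) * coef_fps (msum a b c d) n.
    have := congr1 (fun f : {fps {fps int}} => coef_fps (euler_series * f) N) gm.
    rewrite /cyl_gen mulVKr ?euler_series_unit // mulrC coef_fpsM => E.
    rewrite -[LHS]/(coef_fps (cyl_series s0 s1 s2) N) E; apply: eq_bigr => n _.
    have nN : (n <= N)%N by rewrite -ltnS.
    rewrite [in RHS]mulrC subzn //.
  apply: (has_sum_nat (F := fun n =>
    rpoch q (N%:Z + - n%:Z) * coef_fps (msum a b c d) n)) => n Nn.
  by rewrite rpoch_lt0 ?mul0r //; lia.
have -> : (qpoch_oo q q)^-1 ^+ 2 * L = S; last by [].
have /(congr1 (fun x => qpoch_oo q q * x)) := fps_cvg_unique lim1 lim2.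
move: uP; clear; move: (qpoch_oo q q) => P uP; rewrite mulVKr // => <-.
by rewrite exprS -!mulrA mulVKr.
Qed.

Lemma qpoch_oo_q8 : qpoch_oo q q = \prod_(r < 8) qpoch_oo (q ^+ r.+1) (q ^+ 8).
Proof.
rewrite (qpoch_oo_dissect q (isT : 0 < 8)%N) //.
by apply: eq_bigr => r _; rewrite -exprS.
Qed.

(** Cancelling the three theta products against the square of
    (q; q)_oo = (q, q^2, q^3, q^4, q^5, q^6, q^7, q^8; q^8)_oo. *)
Lemma theta_quotient s0 s1 s2 (l : seq nat) :
  (forall u : nat -> {fps int},
     u 8%N ^+ 2 * (u s0 * u (8 - s0)%N * (u s1 * u (8 - s1)%N) *
       (u s2 * u (8 - s2)%N))
       * \prod_(r <- l) u r = (\prod_(r < 8) u r.+1) ^+ 2) ->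
  all (leq 1) l ->
  (qpoch_oo q q)^-1 ^+ 2 *
    (qpoch_oo (q ^+ 8) (q ^+ 8) ^+ 2
     * (qpoch_oo (q ^+ s0) (q ^+ 8) * qpoch_oo (q ^+ (8 - s0)) (q ^+ 8)
     * (qpoch_oo (q ^+ s1) (q ^+ 8) * qpoch_oo (q ^+ (8 - s1)) (q ^+ 8))
     * (qpoch_oo (q ^+ s2) (q ^+ 8) * qpoch_oo (q ^+ (8 - s2)) (q ^+ 8))))
  = 1 / qpochs_oo [seq q ^+ r | r <- l] (q ^+ 8).
Proof.
move=> ul l0; have uD : qpochs_oo [seq q ^+ r | r <- l] (q ^+ 8) \is a GRing.unit.
  apply: qpochs_oo_unit => [|x /mapP[r rl ->]]; first exact: coef_fpsXn0.
  by apply: coef_fpsXn0; apply: (allP l0).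
have uP : qpoch_oo q q \is a GRing.unit by apply: qpoch_oo_unit.
apply: (mulIr uD); rewrite divrK //.
have := ul (fun r => qpoch_oo (q ^+ r) (q ^+ 8)); rewrite -qpoch_oo_q8.
rewrite /qpochs_oo big_map => h; rewrite -[LHS]mulrA {}h.
by move: (qpoch_oo q q) uP => P uP; rewrite -exprMn mulVr ?expr1n.
Qed.

End Values.

Theorem theorem1p6 :
  let q : {fps int} := fpsX int in
  [/\ fps_has_sum
        (fun n : nat * nat * nat * nat => let: (n1, n2, n3, n4) := n in
           q ^+ (Qform n1 n2 n3 n4 + n1 + n2 + n3 + n4) / qpoch q q n1
             * qbinom q n1 n2 * qbinom q n1 n4 * qbinom q n2 n3)
        (1 / qpochs_oo [:: q ^+ 2; q ^+ 3; q ^+ 3; q ^+ 4;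
                           q ^+ 4; q ^+ 5; q ^+ 5; q ^+ 6] (q ^+ 8)),
      fps_has_sum
        (fun n : nat * nat * nat * nat => let: (n1, n2, n3, n4) := n in
           q ^+ (Qform n1 n2 n3 n4 + n2 + n3 + n4) / qpoch q q n1
             * qbinom q n1 n2 * qbinom q n1 n4 * qbinom q n2 n3)
        (1 / qpochs_oo [:: q; q ^+ 2; q ^+ 3; q ^+ 4;
                           q ^+ 4; q ^+ 5; q ^+ 6; q ^+ 7] (q ^+ 8)),
      fps_has_sum
        (fun n : nat * nat * nat * nat => let: (n1, n2, n3, n4) := n in
           q ^+ (Qform n1 n2 n3 n4 + n3) / qpoch q q n1
             * qbinom q n1 n2 * qbinom q n1 n4 * qbinom q n2 n3)
        (1 / qpochs_oo [:: q; q; q ^+ 3; q ^+ 3;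
                           q ^+ 5; q ^+ 5; q ^+ 7; q ^+ 7] (q ^+ 8))
    & fps_has_sum
        (fun n : nat * nat * nat * nat => let: (n1, n2, n3, n4) := n in
           q ^+ (Qform n1 n2 n3 n4) / qpoch q q n1
             * qbinom q n1 n2 * qbinom q n1 n4 * qbinom q n2 n3)
        (1 / qpochs_oo [:: q; q; q ^+ 2; q ^+ 4;
                           q ^+ 4; q ^+ 6; q ^+ 7; q ^+ 7] (q ^+ 8))].
Proof.
move=> q; have [m500 m410 m311 m221] := cyl_gen_msum.
have val s0 s1 s2 (sK : (s0 + s1 + s2 = 8)%N) a b c d
  (gm : cyl_gen s0 s1 s2 = msum a b c d) :=
  quad_sum_value (isT : 0 < 8)%N sK gm (macdonald_A2 int (isT : 0 < 8)%N sK).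
split.
- have := val 6 1 1 erefl _ _ _ _ m500.
  rewrite (@theta_quotient 6 1 1 [:: 2; 3; 3; 4; 4; 5; 5; 6]%N) //; last first.
    by move=> u; rewrite !big_cons big_nil !big_ord_recl big_ord0 /=; ring.
  by apply: eq_has_sum => -[[[n1 n2] n3] n4]; rewrite /quad_term !mul1n.
- have := val 5 2 1 erefl _ _ _ _ m410.
  rewrite (@theta_quotient 5 2 1 [:: 1; 2; 3; 4; 4; 5; 6; 7]%N) //; last first.
    by move=> u; rewrite !big_cons big_nil !big_ord_recl big_ord0 /=; ring.
  by apply: eq_has_sum => -[[[n1 n2] n3] n4]; rewrite /quad_term !mul1n mul0n addn0.
- have := val 4 2 2 erefl _ _ _ _ m311.
  rewrite (@theta_quotient 4 2 2 [:: 1; 1; 3; 3; 5; 5; 7; 7]%N) //; last first.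
    by move=> u; rewrite !big_cons big_nil !big_ord_recl big_ord0 /=; ring.
  by apply: eq_has_sum => -[[[n1 n2] n3] n4];
    rewrite /quad_term !mul0n mul1n !addn0.
- have := val 3 3 2 erefl _ _ _ _ m221.
  rewrite (@theta_quotient 3 3 2 [:: 1; 1; 2; 4; 4; 6; 7; 7]%N) //; last first.
    by move=> u; rewrite !big_cons big_nil !big_ord_recl big_ord0 /=; ring.
  by apply: eq_has_sum => -[[[n1 n2] n3] n4]; rewrite /quad_term !mul0n !addn0.
Qed.
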